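(* Let $n\ge 2$ and let $A\subset\mathbb{R}^n$ be a regular compact set. If $A$ is convex, then $$\binom{2n}{n}^{-1}\lambda_n(\mathrm{supp}\,g_A)\le g_A(0)\le 2^{-n}\lambda_n(\mathrm{supp}\,g_A)$$ and, for each $u\in\mathbb{S}^{n-1}$, $$\binom{2n-2}{n-1}^{-1}\lambda_{n-1}\big((\mathrm{supp}\,g_A)|u^\perp\big)\le -\frac{\partial g_A}{\partial u}(0)\le 2^{1-n}\lambda_{n-1}\big((\mathrm{supp}\,g_A)|u^\perp\big).$$
   Context: A closed set is regular if it coincides with the closure of its interior. For a compact set $A\subset\mathbb{R}^n$, the covariogram is $g_A(x)=\lambda_n(A\cap(A+x))$, $x\in\mathbb{R}^n$. $\lambda_k$ denotes $k$-dimensional Lebesgue (Hausdorff) measure, $\mathrm{supp}\,f$ is the support of $f$, $\mathbb{S}^{n-1}$ is the unit sphere, $u^\perp$ is the $(n-1)$-dimensional subspace orthogonal to $u$, and $S|u^\perp$ is the orthogonal projection of $S$ on $u^\perp$. The directional derivative at the origin is the one-sided one: $\frac{\partial g_A}{\partial u}(0)=\lim_{h\to0^+}\frac{g_A(hu)-g_A(0)}{h}$. *)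

(* Defs.v *)
From HB Require Import structures.
From mathcomp Require Import all_boot all_order all_algebra.
From mathcomp Require Import ring lra.
From mathcomp Require Import all_classical all_reals all_analysis.

Set Implicit Arguments.
Unset Strict Implicit.
Unset Printing Implicit Defensive.

Import Order.TTheory GRing.Theory Num.Theory.
Import numFieldNormedType.Exports.
Local Open Scope classical_set_scope.
Local Open Scope ring_scope.

Section lebesgue_tuple.
Context {R : realType}.
Local Notation RR := (measurableTypeR R).
Local Open Scope ereal_scope.

Definition tuple_cons {T : Type} {n : nat} (p : T * n.-tuple T) : n.+1.-tuple T :=
  [the n.+1.-tuple T of p.1 :: p.2].

Definition tuple_uncons {T : Type} {n : nat} (t : n.+1.-tuple T) :
  T * n.-tuple T := (thead t, [tuple of behead t]).

Lemma tuple_consK {T : Type} {n : nat} :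
  cancel (@tuple_cons T n) tuple_uncons.
Proof. by case=> x t; congr pair; apply/val_inj. Qed.

Lemma tuple_unconsK {T : Type} {n : nat} :
  cancel (@tuple_uncons T n) tuple_cons.
Proof. by move=> t; rewrite [RHS]tuple_eta; apply/val_inj. Qed.

Lemma measurable_tuple_cons n :
  measurable_fun [set: RR * n.-tuple RR] tuple_cons.
Proof. by apply: (@measurable_cons _ _ _ RR fst n snd). Qed.

Lemma measurable_tuple_uncons n :
  measurable_fun [set: n.+1.-tuple RR] tuple_uncons.
Proof.
apply/measurable_fun_pair; first exact: measurable_tnth.
exact: measurable_behead.
Qed.

Section lebesgue_cons.
Context {n : nat} (mu : {sigma_finite_measure set (n.-tuple RR) -> \bar R}).

Definition lebesgue_cons : set (n.+1.-tuple RR) -> \bar R :=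
  pushforward (@lebesgue_measure R \x mu) tuple_cons.

Let lebesgue_cons0 : lebesgue_cons set0 = 0.
Proof. by rewrite /lebesgue_cons /pushforward preimage_set0 measure0. Qed.

Let lebesgue_cons_ge0 A : 0 <= lebesgue_cons A.
Proof. exact: (measure_ge0 (@lebesgue_measure R \x mu)). Qed.

Let lebesgue_cons_sigma_additive : semi_sigma_additive lebesgue_cons.
Proof.
move=> F mF tF mUF; rewrite /lebesgue_cons /pushforward preimage_bigcup.
have mpre (A : set (n.+1.-tuple RR)) :
    measurable A -> measurable ((@tuple_cons RR n) @^-1` A).
  by move=> mA; rewrite -[X in measurable X]setTI; exact: (measurable_tuple_cons measurableT mA).
apply: (@measure_semi_sigma_additive _ _ _ (@lebesgue_measure R \x mu)).
- by move=> k; exact: mpre.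
- apply/trivIsetP => /= i j _ _ ij; rewrite -preimage_setI.
  by move/trivIsetP : tF => /(_ _ _ _ _ ij) ->//; rewrite preimage_set0.
- by rewrite -preimage_bigcup; exact: mpre.
Qed.

HB.instance Definition _ := isMeasure.Build _ _ _ lebesgue_cons
  lebesgue_cons0 lebesgue_cons_ge0 lebesgue_cons_sigma_additive.

Let lebesgue_cons_sigma_finite : sigma_finite setT lebesgue_cons.
Proof.
have /sigma_finiteP[F [TF ndF Foo]] := sigma_finiteT (@lebesgue_measure R).
have /sigma_finiteP[G [TG ndG Goo]] := sigma_finiteT mu.
exists (fun k => (@tuple_uncons RR n) @^-1` (F k `*` G k)).
  rewrite -preimage_bigcup; apply/seteqP; split => // t _ /=.
  have : setT (tuple_uncons t).1 by [].
  have : setT (tuple_uncons t).2 by [].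
  rewrite TF TG => -[j _ Gj] [i _ Fi]; exists (maxn i j) => //; split.
    by move: Fi; exact/subsetPset/ndF/leq_maxl.
  by move: Gj; exact/subsetPset/ndG/leq_maxr.
move=> k; have [? ?] := Foo k; have [? ?] := Goo k.
have mFG : measurable (F k `*` G k) by exact: measurableX.
split.
  by rewrite -[X in measurable X]setTI; exact: (measurable_tuple_uncons measurableT mFG).
rewrite /lebesgue_cons /pushforward -comp_preimage.
rewrite (_ : _ \o _ = id); last by apply/funext => p; exact: tuple_consK.
rewrite preimage_id product_measure1E// lte_mul_pinfty//.
by rewrite ge0_fin_numE.
Qed.

HB.instance Definition _ := Measure_isSigmaFinite.Build _ _ _ lebesgue_cons
  lebesgue_cons_sigma_finite.

End lebesgue_cons.

(* Lebesgue measure on R^n, on the Borel sigma-algebra of n.-tuple R: the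
   n-fold product of the Lebesgue measure of the line. *)
Fixpoint lebesgue_tuple n : {sigma_finite_measure set (n.-tuple RR) -> \bar R} :=
  match n return {sigma_finite_measure set (n.-tuple RR) -> \bar R} with
  | 0%N => \d_([tuple] : 0.-tuple RR)
  | m.+1 => lebesgue_cons (lebesgue_tuple m)
  end.

Lemma lebesgue_tuple_box n (B : 'I_n -> set RR) :
  (forall i, measurable (B i)) ->
  lebesgue_tuple n [set t | forall i, B i (tnth t i)] =
  \prod_(i < n) lebesgue_measure (B i).
Proof.
elim: n B => [|n IH] B mB /=.
  by rewrite big_ord0 diracE mem_set //= => -[].
rewrite /lebesgue_cons /pushforward big_ord_recl.
rewrite (_ : _ @^-1` _ =
    B ord0 `*` [set t | forall i : 'I_n, B (lift ord0 i) (tnth t i)]); last first.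
  apply/seteqP; split => -[x t] /=.
    move=> h; split; first by have := h ord0; rewrite tnth0.
    by move=> i; have := h (lift ord0 i); rewrite tnthS.
  move=> [Bx Bt] i; case: (unliftP ord0 i) => [j|] ->; last by rewrite tnth0.
  by rewrite tnthS; exact: Bt.
rewrite product_measure1E //.
  by rewrite (IH (fun i => B (lift ord0 i))) //.
rewrite (_ : mkset _ =
    \bigcap_(i in [set: 'I_n]) ((@tnth _ _)^~ i @^-1` B (lift ord0 i))).
  apply: fin_bigcap_measurable => // i _.
  by rewrite -[X in measurable X]setTI; exact: measurable_tnth.
by apply/seteqP; split => t /= h i //; [move=> _; exact: h|exact: h].
Qed.

End lebesgue_tuple.

Section covariogram.
Context {R : realType}.

Definition lebesgue_rV (n : nat) (E : set 'rV[R]_n) : \bar R :=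
  lebesgue_tuple n [set t | E (\row_i tnth t i)].

Definition dotv (n : nat) (x y : 'rV[R]_n) : R := \sum_i x 0 i * y 0 i.

(* The norm of the library on 'rV[R]_n is the sup norm, hence not used here. *)
Definition unit_vector (n : nat) (u : 'rV[R]_n) : Prop := dotv u u = 1.

(* The volume is finite when A is compact, the only case considered, so that
   [fine] loses no information. *)
Definition covariogram (n : nat) (A : set 'rV[R]_n) (x : 'rV[R]_n) : R :=
  fine (lebesgue_rV (A `&` [set a + x | a in A])).

Definition fsupp (n : nat) (f : 'rV[R]_n -> R) : set 'rV[R]_n :=
  closure [set x | f x != 0].

Definition dir_quotient0 (n : nat) (f : 'rV[R]_n -> R) (u : 'rV[R]_n) (h : R) :
  R := (f (h *: u) - f 0) / h.

Definition dir_derivative0 (n : nat) (f : 'rV[R]_n -> R) (u : 'rV[R]_n) : R :=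
  lim (dir_quotient0 f u h @[h --> 0^'+]).

Definition proj_orth (n : nat) (u : 'rV[R]_n) (S : set 'rV[R]_n) :
  set 'rV[R]_n := [set x - dotv x u *: u | x in S].

(* The rows of V form an orthonormal basis of the orthogonal of u, for u a unit
   vector. *)
Definition orth_frame (n : nat) (u : 'rV[R]_n) (V : 'M[R]_(n.-1, n)) : Prop :=
  V *m V^T = 1%:M /\ V *m u^T = 0.

(* (n-1)-dimensional Lebesgue measure of a subset E of the orthogonal of u,
   transported by the linear isometry y |-> y *m V from R^(n-1) onto it, where V
   is any orthonormal frame of it. *)
Definition lebesgue_hyperplane (n : nat) (V : 'M[R]_(n.-1, n))
  (E : set 'rV[R]_n) : \bar R := lebesgue_rV [set y | E (y *m V)].

Lemma dotvE n (x y : 'rV[R]_n) : (dotv x y)%:M = x *m y^T.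
Proof.
apply/matrixP => i j; rewrite !ord1 !mxE eqxx mulr1n.
by apply: eq_bigr => k _; rewrite mxE.
Qed.

Lemma orth_frame_exists n (u : 'rV[R]_n) :
  unit_vector u -> exists V, orth_frame u V.
Proof.
case: n u => [|n] u u1.
  by move: u1; rewrite /unit_vector /dotv big_ord0 => /esym/eqP; rewrite oner_eq0.
suff [H HH Hu] : exists2 H : 'M[R]_n.+1, H *m H^T = 1%:M & row 0 H = u.
  exists (row' 0 H); split.
    apply/matrixP => i j; have /matrixP/(_ (lift 0 i) (lift 0 j)) := HH.
    rewrite !mxE (inj_eq lift_inj) => <-.
    by apply: eq_bigr => k _; rewrite !mxE.
  apply/matrixP => i j; have /matrixP/(_ (lift 0 i) 0) := HH.
  rewrite !mxE eq_sym (negbTE (neq_lift _ _)) mulr0n => h; rewrite -[RHS]h; apply: eq_bigr => k _.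
  by rewrite -Hu !mxE.
pose e : 'rV[R]_n.+1 := delta_mx 0 0.
have [<-|ue] := eqVneq e u.
  by exists 1%:M; [rewrite trmx1 mulmx1|rewrite row1].
pose w := u - e.
have w0 : w *m w^T = (2 * (1 - u 0 0))%:M.
  rewrite -dotvE; congr (_%:M).
  rewrite /dotv mulrBr mulr1.
  have -> : \sum_i w 0 i * w 0 i =
      \sum_i u 0 i * u 0 i + \sum_i (i == 0)%:R * (1 - 2 * u 0 i).
    rewrite -big_split; apply: eq_bigr => i _ /=; rewrite !mxE eqxx /=.
    by case: (i == 0); rewrite /= ?mul1r ?mul0r ?subr0 ?addr0 //; ring.
  rewrite [X in X + _]u1 (bigD1 0) //= ?eqxx mul1r big1 ?addr0.
    by ring.
  by move=> k /negbTE ->; rewrite mul0r.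
have c0 : 1 - u 0 0 != 0.
  apply: contra ue => /eqP c; move: w0; rewrite c mulr0 -dotvE => w0.
  have /eqP : dotv w w = 0.
    by move/matrixP/(_ 0 0): w0; rewrite !mxE eqxx !mulr1n.
  rewrite psumr_eq0; last by move=> i _; rewrite -expr2 sqr_ge0.
  move/allP => h; apply/eqP/esym/subr0_eq/matrixP => i j.
  have := h j (mem_index_enum _); rewrite /= mulf_eq0 orbb => /eqP.
  by rewrite ord1 mxE => ->; rewrite mxE.
pose d := (1 - u 0 0)^-1.
pose P := w^T *m w.
have PT : P^T = P by rewrite trmx_mul trmxK.
have PP : P *m P = (2 * (1 - u 0 0)) *: P.
  by rewrite mulmxA -(mulmxA w^T) w0 mul_mx_scalar scalemxAl.
exists (1%:M - d *: P).
  have -> : (1%:M - d *: P)^T = 1%:M - d *: P.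
    by rewrite raddfB /= trmx1 [(d *: P)^T]linearZ /= PT.
  rewrite mulmxBl !mulmxBr mul1mx mulmx1 mul1mx.
  rewrite -scalemxAl -scalemxAr PP !scalerA.
  have -> : d * d * (2 * (1 - u 0 0)) = d + d.
    rewrite mulrCA -mulrA mulVf // mulr1; ring.
  by rewrite scalerDl opprB addrK subrK.
apply/matrixP => i j; rewrite !ord1 !mxE big_ord1 !mxE eqxx /=.
have -> : u 0 0 - 1 = - (1 - u 0 0) by rewrite opprB.
by rewrite mulNr mulrN mulrA mulVf // mul1r opprK [0 == j]eq_sym; ring.
Qed.

End covariogram.

(* Main.v *)
(* The support of g_A is the difference body DA = A - A, so the first pair of
   inequalities says 2^n |A| <= |DA| <= C(2n, n) |A|.

   Lower bound: Brunn-Minkowski, |K| |L| <= |(K + L)/2|^2, applied to K = A and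
   L = -A.  It is proved by induction on the dimension, slicing by the first
   coordinate; the inductive step is the one-dimensional Prekopa-Leindler
   inequality for the volumes of the slices.

   Upper bound (Rogers-Shephard): if x = t(a - b) with a, b in A and
   0 <= t <= 1, then A n (A + x) contains (1 - t)A + ta, whence
   g_A(x) >= (1 - t)^n |A|.  Integrating over x, with the integral of g_A equal
   to |A|^2 and (1 - t)^n written as the integral of n(1 - s)^(n - 1) over
   [t, 1], leaves |DA| times a Beta integral.

   Derivative: slicing A by lines parallel to u, the volume of A \ (A + hu),
   which is g_A(0) - g_A(hu), lies between h times the volume of the shadow of
   A on the orthogonal of u and h times the volume of that shadow contracted
   towards an interior point, by a factor 1 - O(h).  Hence -dg_A/du(0) is the
   volume of the shadow of A, the shadow of DA is the difference body of the
   shadow of A, and the first part applies in dimension n - 1. *)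

Require Import Defs.
From HB Require Import structures.
From mathcomp Require Import all_boot all_order all_algebra.
From mathcomp Require Import all_classical all_reals all_analysis unstable.
From mathcomp Require Import measurable_realfun ring lra.

Import Order.TTheory GRing.Theory Num.Theory.
Import numFieldNormedType.Exports.
Local Open Scope classical_set_scope.
Local Open Scope ring_scope.

Set Implicit Arguments.
Unset Strict Implicit.
Unset Printing Implicit Defensive.

(** * Lebesgue measure on row vectors *)

(** Opaque, so that the sigma-algebra on row vectors has a display of its own. *)
Definition rV_display : measure_display.
Proof. exact: default_measure_display. Qed.

Section lebesgue_rV_measure.
Context {R : realType}.
Local Notation RR := (measurableTypeR R).
Local Notation mu := (@lebesgue_measure R).

Definition rV_of_tuple n (t : n.-tuple RR) : 'rV[R]_n := \row_i tnth t i.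

Definition tuple_of_rV n (x : 'rV[R]_n) : n.-tuple RR := [tuple x 0 i | i < n].

Lemma tuple_of_rVK n : cancel (@tuple_of_rV n) (@rV_of_tuple n).
Proof. by move=> x; apply/rowP => i; rewrite mxE tnth_mktuple. Qed.

Section instances.
Variable n : nat.

(* 'rV[R]_n carries no sigma-algebra in the library; this one makes
   [lebesgue_rV] a measure, so that Fubini applies to it directly. *)
Definition rV_measurable : set (set 'rV[R]_n) :=
  [set E | measurable (@rV_of_tuple n @^-1` E)].

Let rV_measurable0 : rV_measurable set0.
Proof. by rewrite /rV_measurable /= preimage_set0. Qed.

Let rV_measurableC E : rV_measurable E -> rV_measurable (~` E).
Proof. by move=> mE; rewrite /rV_measurable /= preimage_setC; exact: measurableC. Qed.

Let rV_measurable_bigcup (F : (set 'rV[R]_n)^nat) :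
  (forall i, rV_measurable (F i)) -> rV_measurable (\bigcup_i F i).
Proof.
by move=> mF; rewrite /rV_measurable /= preimage_bigcup; exact: bigcupT_measurable.
Qed.

HB.instance Definition _ := @isMeasurable.Build rV_display
  'rV[R]_n rV_measurable rV_measurable0 rV_measurableC rV_measurable_bigcup.

Lemma measurable_rV_of_tuple : measurable_fun setT (@rV_of_tuple n).
Proof. by move=> _ Y mY; rewrite setTI. Qed.

Local Open Scope ereal_scope.

Let lebesgue_rV0 : @lebesgue_rV R n set0 = 0.
Proof. exact: measure0. Qed.

Let lebesgue_rV_ge0 (E : set 'rV[R]_n) : 0 <= lebesgue_rV E.
Proof. exact: measure_ge0. Qed.

Let lebesgue_rV_sigma_additive : semi_sigma_additive (@lebesgue_rV R n).
Proof.
move=> F mF tF mUF; rewrite /lebesgue_rV.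
rewrite (_ : mkset _ = \bigcup_k (@rV_of_tuple n @^-1` F k)); last first.
  by rewrite -preimage_bigcup.
apply: (@measure_semi_sigma_additive _ _ _ (lebesgue_tuple n)).
- by move=> k; exact: mF.
- apply/trivIsetP => /= i j _ _ ij; rewrite -preimage_setI.
  by move/trivIsetP : tF => /(_ _ _ _ _ ij) ->//; rewrite preimage_set0.
- by rewrite -preimage_bigcup; exact: mUF.
Qed.

HB.instance Definition _ := isMeasure.Build _ _ _ (@lebesgue_rV R n)
  lebesgue_rV0 lebesgue_rV_ge0 lebesgue_rV_sigma_additive.

Let lebesgue_rV_sigma_finite : sigma_finite setT (@lebesgue_rV R n).
Proof.
have [F TF Foo] := sigma_finiteT (@lebesgue_tuple R n).
have FK k : @rV_of_tuple n @^-1` ((@tuple_of_rV n) @^-1` F k) = F k.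
  apply/seteqP; split => t /=; have -> // : tuple_of_rV (rV_of_tuple t) = t.
    by apply/eq_from_tnth => i; rewrite tnth_mktuple mxE.
  by apply/eq_from_tnth => i; rewrite tnth_mktuple mxE.
exists (fun k => (@tuple_of_rV n) @^-1` F k).
  by rewrite -preimage_bigcup -TF preimage_setT.
move=> k; have [mF Fk] := Foo k; split.
  by rewrite /measurable /= /rV_measurable /= FK.
rewrite (_ : lebesgue_rV _ = lebesgue_tuple n (F k))//.
by rewrite -[in RHS](FK k).
Qed.

HB.instance Definition _ := Measure_isSigmaFinite.Build _ _ _ (@lebesgue_rV R n)
  lebesgue_rV_sigma_finite.

End instances.

Lemma measurable_coord n (i : 'I_n) :
  measurable_fun setT (fun x : 'rV[R]_n => x 0 i : RR).
Proof.
move=> _ Y mY; rewrite setTI /measurable /= /rV_measurable /=.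
rewrite (_ : _ @^-1` _ = (@tnth _ _)^~ i @^-1` Y); last first.
  by apply/seteqP; split => t /=; rewrite mxE.
by rewrite -[X in measurable X]setTI; exact: measurable_tnth.
Qed.

Lemma measurable_fun_rV d (T : measurableType d) n (f : T -> 'rV[R]_n) :
  (forall i, measurable_fun setT (fun x => f x 0 i : RR)) ->
  measurable_fun setT f.
Proof.
move=> mf; rewrite (_ : f = @rV_of_tuple n \o (@tuple_of_rV n \o f)); last first.
  by apply/funext => x /=; rewrite tuple_of_rVK.
apply: measurableT_comp; first exact: measurable_rV_of_tuple.
apply/measurable_fun_tnthP => i; apply: eq_measurable_fun (mf i) => x _ /=.
by rewrite tnth_mktuple.
Qed.

Definition rV_cons n (s : R) (y : 'rV[R]_n) : 'rV[R]_n.+1 := row_mx (s%:M : 'rV_1) y.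

Lemma rV_cons0 n s (y : 'rV[R]_n) : rV_cons s y 0 0 = s.
Proof.
rewrite [X in rV_cons _ _ _ X](_ : _ = lshift n (0 : 'I_1)); last exact: val_inj.
by apply: etrans (row_mxEl _ _ _ _) _; rewrite mxE eqxx mulr1n.
Qed.

Lemma rV_consS n s (y : 'rV[R]_n) i : rV_cons s y 0 (lift ord0 i) = y 0 i.
Proof.
rewrite (_ : lift ord0 i = rshift 1 i); last exact: val_inj.
exact: row_mxEr.
Qed.

Lemma measurable_rV_cons n :
  measurable_fun setT (fun p : RR * 'rV[R]_n => rV_cons p.1 p.2).
Proof.
apply: measurable_fun_rV => i; case: (unliftP ord0 i) => [j|] ->.
  under eq_fun do rewrite rV_consS.
  by apply: (measurableT_comp (measurable_coord j)).
under eq_fun do rewrite rV_cons0.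
exact: measurable_fst.
Qed.

(** Both sides unfold to the integral over the first coordinate of the measures of the sections,
    [lebesgue_tuple] being a pushforward along [tuple_cons]. *)
Lemma lebesgue_rVS n (E : set 'rV[R]_n.+1) :
  lebesgue_rV E = (mu \x @lebesgue_rV R n)%E [set p | E (rV_cons p.1 p.2)].
Proof.
rewrite /lebesgue_rV /= /lebesgue_cons /pushforward /product_measure1.
apply: eq_integral => s _ /=; congr (lebesgue_tuple n _).
apply/seteqP; split => t; rewrite /xsection /= !inE /=.
  rewrite (_ : rV_cons _ _ = \row_i tnth (tuple_cons (s, t)) i)//.
  apply/rowP => i; case: (unliftP ord0 i) => [j|] ->.
    by rewrite rV_consS !mxE tnthS.
  by rewrite rV_cons0 mxE tnth0.
rewrite (_ : rV_cons _ _ = \row_i tnth (tuple_cons (s, t)) i)//.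
apply/rowP => i; case: (unliftP ord0 i) => [j|] ->.
  by rewrite rV_consS !mxE tnthS.
by rewrite rV_cons0 mxE tnth0.
Qed.

Lemma lebesgue_rV_box n (B : 'I_n -> set RR) : (forall i, measurable (B i)) ->
  lebesgue_rV [set x : 'rV[R]_n | forall i, B i (x 0 i)] =
  (\prod_(i < n) mu (B i))%E.
Proof.
move=> mB; rewrite -lebesgue_tuple_box// /lebesgue_rV; congr (lebesgue_tuple n _).
by apply/seteqP; split => t /= h i; move: (h i); rewrite mxE.
Qed.

Lemma measurable_preimage d d' (T : measurableType d) (U : measurableType d')
  (f : T -> U) (E : set U) : measurable_fun setT f -> measurable E ->
  measurable (f @^-1` E).
Proof. by move=> mf mE; rewrite -[X in measurable X]setTI; exact: mf. Qed.

Lemma measurable_box n (B : 'I_n -> set RR) : (forall i, measurable (B i)) ->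
  measurable [set x : 'rV[R]_n | forall i, B i (x 0 i)].
Proof.
move=> mB; rewrite (_ : mkset _ =
    \bigcap_(i in [set: 'I_n]) ((fun x : 'rV_n => x 0 i) @^-1` B i)).
  apply: fin_bigcap_measurable => // i _.
  exact: measurable_preimage (measurable_coord i) (mB i).
by apply/seteqP; split => t /= h i //; [move=> _; exact: h|exact: h].
Qed.

Lemma measurable_mulmx m n (Q : 'M[R]_(m, n)) :
  measurable_fun setT (fun x : 'rV[R]_m => x *m Q).
Proof.
apply: measurable_fun_rV => i.
under eq_fun do rewrite mxE.
apply: measurable_sum => k; apply: measurable_funM => //.
exact: measurable_coord.
Qed.

Lemma measurable_scale n c : measurable_fun setT (fun x : 'rV[R]_n => c *: x).
Proof.
apply: measurable_fun_rV => i.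
under eq_fun do rewrite mxE.
by apply: measurable_funM => //; exact: measurable_coord.
Qed.

(** Balls of the sup norm are boxes, so an open set is the union of the countably many boxes with
    rational centre and radius that it contains. *)
Lemma open_measurable_rV n (U : set 'rV[R]_n) : open U -> measurable U.
Proof.
move=> oU.
pose box (p : {ffun 'I_n -> rat} * rat) : set 'rV[R]_n :=
  [set x | forall i, ball (ratr (p.1 i) : R) (ratr p.2) (x 0 i)].
have mbox p : measurable (box p).
  apply: (@measurable_box _ (fun i => ball (ratr (p.1 i) : R) (ratr p.2))) => i.
  exact: measurable_ball.
have -> : U = \bigcup_(p in [set p | box p `<=` U]) box p; last first.
  rewrite bigcup_mkcond; apply: countable_bigcupT_measurable => // p.
  by case: ifP.
apply/seteqP; split => [x Ux|x [p pU]]; last exact: pU.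
have /nbhs_ballP[e /= e0 xeU] : nbhs x U by exact: open_nbhs_nbhs.
(* With radius below e / 2, any box containing [x] lies within distance e of [x]. *)
have [r] := @rat_in_itvoo R 0 (e / 2) (divr_gt0 e0 (ltr0Sn _ 1)).
rewrite in_itv /= => /andP[r0 re].
have /choice[q qx] (i : 'I_n) : exists q : rat, ball (ratr q : R) (ratr r) (x 0 i).
  have [q] := @rat_in_itvoo R (x 0 i) (x 0 i + ratr r) (ltr_pwDr r0 (lexx _)).
  rewrite in_itv /= => /andP[xq qx]; exists q.
  by rewrite /ball /= ger0_norm ?subr_ge0 ?ltW// ltrBlDl.
exists ([ffun i => q i], r) => /=; last by move=> i; rewrite ffunE.
move=> y xy; apply: xeU; split => // i j; rewrite !ord1.
have := xy j; rewrite /= ffunE => /(ball_triangle (ball_sym (qx j))).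
by apply: le_ball; rewrite [leRHS]splitr lerD// ltW.
Qed.

Lemma closed_measurable_rV n (C : set 'rV[R]_n) : closed C -> measurable C.
Proof.
move=> cC; rewrite -(setCK C); apply: measurableC; apply: open_measurable_rV.
exact: closed_openC.
Qed.

Lemma compact_measurable_rV n (C : set 'rV[R]_n) : compact C -> measurable C.
Proof.
move=> cC; apply: closed_measurable_rV; apply: compact_closed cC.
exact: (@norm_hausdorff R 'rV[R]_n).
Qed.

End lebesgue_rV_measure.

(** * Translations *)

Section lebesgue_rV_translation.
Context {R : realType}.
Local Notation RR := (measurableTypeR R).
Local Notation mu := (@lebesgue_measure R).
Local Open Scope ereal_scope.

(** The image of the Lebesgue measure under a translation has the same values on half-open
    intervals, which determine it. *)
Lemma lebesgue_measure_shift (a : R) (E : set RR) : measurable E ->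
  mu [set x | E (x + a)%R] = mu E.
Proof.
move=> mE.
have mf : measurable_fun setT (fun x : RR => (x + a)%R : RR).
  exact: measurable_funD.
rewrite [RHS](@lebesgue_measure_unique R
  (measure_function_pushforward__canonical__measure_function_Measure mu mf))//=.
move=> _ [[b c]] _ <-.
rewrite /pushforward (_ : _ @^-1` _ = `](b - a)%R, (c - a)%R]%classic); last first.
  by apply/seteqP; split => x /=; rewrite !in_itv /= ltrBlDr lerBrDr.
rewrite !lebesgue_measure_itv /= !lte_fin ltrD2r; case: ifP => // _.
by rewrite -!EFinD; congr EFin; ring.
Qed.

(** Tonelli for indicator functions: the product measures obtained by integrating in either order
    agree on rectangles, hence on all measurable sets. *)
Lemma product_measure_swap d1 d2 (T1 : measurableType d1) (T2 : measurableType d2)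
    (m1 : {sigma_finite_measure set T1 -> \bar R})
    (m2 : {sigma_finite_measure set T2 -> \bar R}) (E : set (T1 * T2)) :
  measurable E ->
  \int[m1]_x m2 [set y | E (x, y)] = \int[m2]_y m1 [set x | E (x, y)].
Proof.
move=> mE; transitivity ((m1 \x m2) E).
  by apply: eq_integral => x _ /=; congr (m2 _); apply/seteqP; split => y;
    rewrite /xsection /= inE.
rewrite (@product_measure_unique _ _ _ _ _ m1 m2 (m1 \x^ m2))//; last first.
  by move=> A B mA mB; exact: product_measure2E.
by apply: eq_integral => y _ /=; congr (m1 _); apply/seteqP; split => x;
    rewrite /ysection /= inE.
Qed.

Lemma measurable_section1 d1 d2 (T1 : measurableType d1) (T2 : measurableType d2)
    (E : set (T1 * T2)) x : measurable E -> measurable [set y | E (x, y)].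
Proof.
move=> mE; have := measurable_xsection x mE.
by congr measurable; apply/seteqP; split => y; rewrite /xsection /= inE.
Qed.

Lemma measurable_fun_section1 d1 d2 (T1 : measurableType d1) (T2 : measurableType d2)
    (m2 : {sigma_finite_measure set T2 -> \bar R}) (E : set (T1 * T2)) :
  measurable E -> measurable_fun setT (fun x => m2 [set y | E (x, y)]).
Proof.
move=> mE; apply: eq_measurable_fun (measurable_fun_xsection m2 mE) => x _ /=.
by congr (m2 _); apply/seteqP; split => y; rewrite /xsection /= inE.
Qed.

Lemma lebesgue_rVSE n (E : set 'rV[R]_n.+1) :
  lebesgue_rV E = \int[mu]_s lebesgue_rV [set y | E (rV_cons s y)].
Proof.
rewrite lebesgue_rVS /product_measure1; apply: eq_integral => s _ /=.
by congr (lebesgue_rV _); apply/seteqP; split => y; rewrite /xsection /= inE.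
Qed.

Lemma measurable_rV_section n (E : set 'rV[R]_n.+1) s : measurable E ->
  measurable [set y | E (rV_cons s y)].
Proof.
move=> mE; apply: (@measurable_section1 _ _ _ _ [set p : RR * _ | E (rV_cons p.1 p.2)]).
exact: measurable_preimage (@measurable_rV_cons R n) mE.
Qed.

Lemma measurable_fun_rV_section n (E : set 'rV[R]_n.+1) : measurable E ->
  measurable_fun setT (fun s : RR => lebesgue_rV [set y | E (rV_cons s y)]).
Proof.
move=> mE; apply: (@measurable_fun_section1 _ _ _ _ _ [set p : RR * _ | E (rV_cons p.1 p.2)]).
exact: measurable_preimage (@measurable_rV_cons R n) mE.
Qed.

Lemma ge0_integral_lebesgue_shift (f : RR -> \bar R) a :
  measurable_fun setT f -> (forall x, 0 <= f x) ->
  \int[mu]_x f (x + a)%R = \int[mu]_x f x.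
Proof.
move=> mf f0.
have ma : measurable_fun setT (fun x : RR => (x + a)%R : RR).
  exact: measurable_funD.
have := @ge0_integral_pushforward _ _ _ _ _ _ ma mu setT f measurableT mf (fun x _ => f0 x).
rewrite preimage_setT => <-; apply: eq_measure_integral => A mA _.
exact: lebesgue_measure_shift.
Qed.

(** Induction on the dimension: the sections are translated by the induction hypothesis, the first
    coordinate by the one-dimensional case. *)
Lemma lebesgue_rV_shift n (a : 'rV[R]_n) (E : set 'rV[R]_n) : measurable E ->
  lebesgue_rV [set x | E (x + a)%R] = lebesgue_rV E.
Proof.
elim: n a E => [|n IH] a E mE.
  by congr lebesgue_rV; apply/seteqP; split => x /=; rewrite (thinmx0 (x + a)%R) (thinmx0 x).
rewrite !lebesgue_rVSE -[RHS](@ge0_integral_lebesgue_shift _ (a 0 0)%R); last 2 first.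
- exact: measurable_fun_rV_section.
- by move=> s; exact: measure_ge0.
apply: eq_integral => s _.
rewrite -[RHS](IH (\row_i a 0 (lift ord0 i))%R); last exact: measurable_rV_section.
have rV_consD y : (rV_cons s y + a = rV_cons (s + a 0 0) (y + \row_i a 0 (lift ord0 i)))%R.
  by apply/rowP => i; case: (unliftP ord0 i) => [j|] ->;
    rewrite mxE ?rV_consS ?rV_cons0 ?mxE.
by congr lebesgue_rV; apply/seteqP; split => y /=; rewrite rV_consD.
Qed.

End lebesgue_rV_translation.

(** * Linear images *)

Section lebesgue_rV_linear.
Context {R : realType}.
Local Notation RR := (measurableTypeR R).
Local Notation mu := (@lebesgue_measure R).
Local Open Scope ereal_scope.

(** The integrand is [c] on [E] and zero off it. This evaluates the iterated integrals in the Fubini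
    arguments below. *)
Lemma integral_measure_and d (T : measurableType d) (m : {measure set T -> \bar R})
    d' (U : measurableType d') (m' : {measure set U -> \bar R})
    (E : set T) (G : T -> set U) c :
  measurable E -> (forall x, E x -> m' (G x) = c) ->
  \int[m]_x m' [set y | E x /\ G x y] = m E * c.
Proof.
move=> mE Gc; rewrite muleC -integral_cst// [in RHS]integral_mkcond.
apply: eq_integral => x _; rewrite patchE; case: ifPn => [|] xE.
  move: xE; rewrite inE => xE; rewrite -[RHS](Gc x xE).
  by congr (m' _); apply/seteqP; split => y //= [].
rewrite (_ : mkset _ = set0) ?measure0//.
by apply/seteqP; split => // y [] /mem_set; rewrite (negbTE xE).
Qed.

Lemma measurable_fun_rVD d (T : measurableType d) n (f g : T -> 'rV[R]_n) :
  measurable_fun setT f -> measurable_fun setT g ->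
  measurable_fun setT (fun x => f x + g x)%R.
Proof.
move=> mf mg; apply: measurable_fun_rV => i.
under eq_fun do rewrite mxE.
by apply: measurable_funD; apply: (measurableT_comp (measurable_coord i)).
Qed.

Lemma measurable_oppr_rV n : measurable_fun setT (fun x : 'rV[R]_n => - x)%R.
Proof. under eq_fun do rewrite -scaleN1r; exact: measurable_scale. Qed.

(* The Fubini argument for uniqueness of the Haar measure: both sides are the
   measure of the pairs (x, y) with xQ in E and y + xQ in F.  Taking for F a set
   of known behaviour under Q (a cube, the Euclidean ball) gives the effect of
   Q on volumes without determinants. *)
Lemma lebesgue_rV_mulmx_swap n (Q : 'M[R]_n) (E F : set 'rV[R]_n) :
  Q \in unitmx -> measurable E -> measurable F ->
  lebesgue_rV [set x | E (x *m Q)%R] * lebesgue_rV F =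
  lebesgue_rV [set x | F (x *m Q)%R] * lebesgue_rV [set y | E (- y)%R].
Proof.
move=> Qu mE mF.
have mQ := measurable_mulmx Q.
have mN := @measurable_oppr_rV n.
have mEQ := measurable_preimage mQ mE.
have mFQ := measurable_preimage mQ mF.
have mEN := measurable_preimage mN mE.
have m1 : measurable_fun setT (fun p : 'rV[R]_n * 'rV[R]_n => p.1 *m Q)%R.
  by apply: measurableT_comp mQ _.
rewrite -(@integral_measure_and _ _ (@lebesgue_rV R n) _ _ (@lebesgue_rV R n) _
   (fun x => [set y | F (y + x *m Q)%R]))//; last first.
  by move=> x _; exact: lebesgue_rV_shift.
rewrite (@product_measure_swap _ _ _ _ _ _ _
  [set p | E (p.1 *m Q)%R /\ F (p.2 + p.1 *m Q)%R]); last first.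
  apply: measurableI; first exact: measurable_preimage m1 mE.
  apply: (measurable_preimage (f := fun p : 'rV[R]_n * 'rV[R]_n => p.2 + p.1 *m Q)%R) mF.
  exact: measurable_fun_rVD.
transitivity (\int[@lebesgue_rV R n]_y
    lebesgue_rV [set x | F (x *m Q)%R /\ E (- (y - x *m Q))%R]).
  apply: eq_integral => y _.
  (* For fixed y, translating x by -y Q^-1 replaces xQ by xQ - y: the conditions become xQ - y in
     [E] and xQ in [F]. *)
  apply: etrans (esym (@lebesgue_rV_shift _ _ (- (y *m invmx Q))%R _ _)) _.
    apply: measurableI => //.
    apply: (measurable_preimage (f := fun x : 'rV[R]_n => y + x *m Q)%R) mF.
    exact: measurable_fun_rVD.
  have e x : ((x - y *m invmx Q) *m Q = x *m Q - y)%R.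
    by rewrite mulmxBl mulmxKV.
  by congr lebesgue_rV; apply/seteqP; split => x /=;
    rewrite e opprB (addrC y) subrK => -[].
rewrite -(@product_measure_swap _ _ _ _ _ (@lebesgue_rV R n) (@lebesgue_rV R n)
  [set p | F (p.1 *m Q)%R /\ E (- (p.2 - p.1 *m Q))%R]); last first.
  apply: measurableI; first exact: measurable_preimage m1 mF.
  apply: (measurable_preimage (f := fun p : 'rV[R]_n * 'rV[R]_n => p.2 - p.1 *m Q)%R) mEN.
  apply: measurable_fun_rVD => //; exact: measurableT_comp mN m1.
apply: (@integral_measure_and _ _ (@lebesgue_rV R n) _ _ (@lebesgue_rV R n)
   [set x | F (x *m Q)%R]
   (fun x => [set y | E (- (y - x *m Q))%R])) => // x _.
exact: (@lebesgue_rV_shift _ _ (- (x *m Q))%R).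
Qed.

Lemma lebesgue_rV_cube n (a : R) : (0 <= a)%R ->
  lebesgue_rV [set x : 'rV[R]_n | forall i, `[0%R, a]%classic (x 0%R i)] = (a ^+ n)%:E.
Proof.
move=> a0; rewrite (@lebesgue_rV_box _ _ (fun=> `[0%R, a]%classic))//.
rewrite (eq_bigr (fun=> a%:E)); last first.
  move=> i _; rewrite lebesgue_measure_itv /= lte_fin sube0.
  by case: ltgtP a0 => // <-.
by rewrite prodEFin prodr_const card_ord.
Qed.

(** The swap with the identity matrix and the unit cube, which has measure one. *)
Lemma lebesgue_rVN n (E : set 'rV[R]_n) : measurable E ->
  lebesgue_rV [set y | E (- y)%R] = lebesgue_rV E.
Proof.
move=> mE; have mC : measurable [set x : 'rV[R]_n | forall i, `[0%R, 1%R]%classic (x 0%R i)].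
  exact: (@measurable_box _ _ (fun=> `[0%R, 1%R]%classic)).
have := @lebesgue_rV_mulmx_swap n 1%:M%R _ _ (unitmx1 _ _) mE mC.
under eq_set do rewrite mulmx1.
under [in RHS]eq_set do rewrite mulmx1.
by rewrite lebesgue_rV_cube// expr1n mule1 mul1e.
Qed.

Lemma lebesgue_rV_mulmx n (Q : 'M[R]_n) (E F : set 'rV[R]_n) :
  Q \in unitmx -> measurable E -> measurable F ->
  lebesgue_rV [set x | E (x *m Q)%R] * lebesgue_rV F =
  lebesgue_rV [set x | F (x *m Q)%R] * lebesgue_rV E.
Proof. by move=> ? mE ?; rewrite lebesgue_rV_mulmx_swap// lebesgue_rVN. Qed.

(** Comparison with the unit cube, which the scaling turns into the cube of side [c]. *)
Lemma lebesgue_rV_scale n (c : R) (E : set 'rV[R]_n) : (0 < c)%R -> measurable E ->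
  lebesgue_rV [set x | E (c^-1 *: x)%R] = (c ^+ n)%:E * lebesgue_rV E.
Proof.
move=> c0 mE.
pose C a := [set x : 'rV[R]_n | forall i, `[0%R, a]%classic (x 0%R i)].
have mC : measurable (C 1%R) by exact: (@measurable_box _ _ (fun=> `[0%R, 1%R]%classic)).
have cu : (c^-1)%:M%R \in @unitmx R n.
  by rewrite unitmxE det_scalar unitrX// unitfE invr_eq0 gt_eqF.
have := lebesgue_rV_mulmx cu mE mC.
rewrite lebesgue_rV_cube// expr1n mule1.
rewrite (_ : [set x | C _ _] = C c); last first.
  apply/seteqP; split => x /= h i; move: (h i); rewrite mul_mx_scalar /= !mxE !in_itv /=.
    by rewrite pmulr_rge0 ?invr_gt0// ler_pdivrMl// mulr1.
  by rewrite pmulr_rge0 ?invr_gt0// ler_pdivrMl// mulr1.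
rewrite lebesgue_rV_cube ?ltW// => <-.
by congr lebesgue_rV; apply/seteqP; split => x /=; rewrite mul_mx_scalar.
Qed.

Lemma measurable_dotv_le1 n : measurable [set x : 'rV[R]_n | (dotv x x <= 1)%R].
Proof.
rewrite (_ : mkset _ = (fun x : 'rV[R]_n => dotv x x) @^-1` `]-oo, 1%R]%classic); last first.
  by apply/seteqP; split => x /=; rewrite in_itv.
apply: measurable_preimage; last exact: measurable_itv.
apply: measurable_sum => i; apply: measurable_funM; exact: measurable_coord.
Qed.

Lemma dotv_mulmx m n (Q : 'M[R]_(m, n)) (x y : 'rV[R]_m) :
  (Q *m Q^T = 1%:M)%R -> dotv (x *m Q)%R (y *m Q)%R = dotv x y.
Proof.
move=> QQ; have /matrixP/(_ 0%R 0%R) := dotvE (x *m Q)%R (y *m Q)%R.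
by rewrite trmx_mul mulmxA -(mulmxA x) QQ mulmx1 -dotvE !mxE eqxx !mulr1n.
Qed.

(** Comparison with the Euclidean unit ball [B], which is invariant under [Q]; its measure is
    positive and finite, hence cancels. *)
Lemma lebesgue_rV_orthogonal n (Q : 'M[R]_n) (E : set 'rV[R]_n) :
  (Q *m Q^T = 1%:M)%R -> measurable E ->
  lebesgue_rV [set x | E (x *m Q)%R] = lebesgue_rV E.
Proof.
move=> QQ mE.
have Qu : Q \in unitmx by have [] := mulmx1_unit QQ.
have mB := @measurable_dotv_le1 n.
set B := mkset _ in mB.
have := lebesgue_rV_mulmx Qu mE mB.
rewrite (_ : [set x | B _] = B); last first.
  by apply/seteqP; split => x; rewrite /B /= dotv_mulmx.
rewrite [LHS]muleC => h.
suff [B0 Bfin] : 0 < lebesgue_rV B /\ lebesgue_rV B \is a fin_num.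
  apply: le_anti.
  by rewrite -(lee_pmul2l Bfin B0) -[X in _ && X](lee_pmul2l Bfin B0) h lexx.
split; last first.
  rewrite ge0_fin_numE//.
  apply: (@le_lt_trans _ _
    (lebesgue_rV [set x : 'rV[R]_n | forall i, `[(- 1)%R, 1%R]%classic (x 0%R i)])).
    apply: le_measure; rewrite ?inE//.
      exact: (@measurable_box _ _ (fun=> `[(- 1)%R, 1%R]%classic)).
    move=> x Bx i /=; rewrite in_itv /= -ler_norml -(@ler_sqr _ `|_|%R) ?nnegrE// expr1n.
    rewrite real_normK ?num_real//; apply: le_trans Bx.
    by rewrite /dotv (bigD1 i)//= -expr2 lerDl sumr_ge0// => j _; rewrite -expr2 sqr_ge0.
  rewrite (@lebesgue_rV_box _ _ (fun=> `[(- 1)%R, 1%R]%classic))//.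
  rewrite (eq_bigr (fun=> 2%:E)) ?prodEFin ?ltry// => i _.
  rewrite lebesgue_measure_itv /= lte_fin ifT; last lra.
  by rewrite -EFinD opprK.
(* The cube of side 1/(n+1) lies in [B]: each of the n squares is at most 1/(n+1). *)
apply: (@lt_le_trans _ _ (((n.+1%:R^-1) ^+ n)%R)%:E).
  by rewrite lte_fin exprn_gt0// invr_gt0.
rewrite -lebesgue_rV_cube ?invr_ge0//.
apply: le_measure; rewrite ?inE//.
  exact: (@measurable_box _ _ (fun=> `[0%R, (n.+1%:R^-1)%R]%classic)).
move=> x /= hx; rewrite /B /= /dotv.
apply: (@le_trans _ _ (\sum_(i < n) n.+1%:R^-1)%R).
  apply: ler_sum => i _; have := hx i; rewrite /= in_itv /= => /andP[x0 x1].
  apply: (le_trans _ x1); rewrite ler_piMl//; apply: (le_trans x1).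
  by rewrite invf_le1// ler1n.
rewrite sumr_const card_ord -[leLHS]mulr_natl ler_pdivrMr// mul1r ler_nat//.
Qed.

End lebesgue_rV_linear.

(** * The Brunn-Minkowski inequality *)

Section brunn_minkowski.
Context {R : realType}.
Local Notation RR := (measurableTypeR R).
Local Notation mu := (@lebesgue_measure R).
Local Open Scope ereal_scope.

Lemma lebesgue_measure_rV1 (E : set RR) : measurable E ->
  mu E = lebesgue_rV [set x : 'rV[R]_1 | E (x 0%R 0%R)].
Proof.
move=> mE; rewrite (_ : mkset _ = [set x : 'rV_1 | forall i, E (x 0%R i)]).
  by rewrite (@lebesgue_rV_box _ 1 (fun=> E))// big_ord1.
by apply/seteqP; split => x /= h; [move=> i; rewrite ord1|exact: h].
Qed.

Lemma lebesgue_measure_scale (c : R) (E : set RR) : (0 < c)%R -> measurable E ->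
  mu [set x | E (c^-1 * x)%R] = c%:E * mu E.
Proof.
move=> c0 mE; rewrite !lebesgue_measure_rV1//; last first.
  by apply: (measurable_preimage (f := fun x : RR => (c^-1 * x)%R)) => //;
    exact: measurable_funM.
rewrite -[in RHS](expr1 c) -lebesgue_rV_scale//; last first.
  exact: (measurable_preimage (f := fun x : 'rV[R]_1 => x 0%R 0%R : RR)
    (@measurable_coord R 1 0%R) mE).
by congr lebesgue_rV; apply/seteqP; split => x /=; rewrite mxE.
Qed.

(* With i in I nearly maximal and j in J nearly minimal, I + j and i + J nearly
   do not overlap, and both lie in 2S. *)
Lemma lebesgue_measure_midpoint (b : R) (I J S : set RR) :
  measurable I -> measurable J -> measurable S -> I !=set0 -> J !=set0 ->
  (forall x, I x -> `|x| <= b)%R -> (forall x, J x -> `|x| <= b)%R ->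
  (forall x y, I x -> J y -> S (2^-1 * (x + y))%R) ->
  mu I + mu J <= 2%:E * mu S.
Proof.
move=> mI mJ mS I0 J0 Ib Jb IJS.
have supI : has_sup I.
  by split => //; exists b => x /Ib; rewrite ler_norml => /andP[].
have infJ : has_inf J.
  by split => //; exists (- b)%R => x /Jb; rewrite ler_norml => /andP[].
rewrite -lebesgue_measure_scale//.
set S2 := mkset _.
have mS2 : measurable S2.
  by apply: (measurable_preimage (f := fun x : RR => (2^-1 * x)%R)) => //;
    exact: measurable_funM.
apply/lee_addgt0Pr => e e0.
have [i Ii ie] := sup_adherent (divr_gt0 e0 (ltr0Sn R 1)) supI.
have [j Jj je] := inf_adherent (divr_gt0 e0 (ltr0Sn R 1)) infJ.
pose A : set RR := [set x | I (x + - j)%R].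
pose B : set RR := [set x | J (x + - i)%R].
have mshift (E : set RR) a : measurable E -> measurable [set x | E (x + a)%R].
  by apply: (measurable_preimage (f := fun x : RR => (x + a)%R)); exact: measurable_funD.
have mA : measurable A by exact: mshift.
have mB : measurable B by exact: mshift.
rewrite -(lebesgue_measure_shift (- j) mI) -(lebesgue_measure_shift (- i) mJ).
rewrite -[X in _ + X <= _]/(mu B) (measureDI mu mB mA) addeA -measureU//; last 2 first.
- exact: measurableD.
- by rewrite setDE setIC -setIA setICl setI0.
apply: leeD.
  apply: le_measure; rewrite ?inE//; first by apply: measurableU => //; exact: measurableD.
  move=> x; rewrite /A /B /S2 /= => -[Ix|[Jx _]].
    by have := IJS _ _ Ix Jj; rewrite subrK.
  by have := IJS _ _ Ii Jx; rewrite addrC subrK.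
(* The overlap of [A] and [B] lies between i + inf J and j + sup I, which by the choice of [i] and
   [j] has length at most e. *)
apply: (@le_trans _ _ (mu `[(i + inf J)%R, (j + sup I)%R]%classic)).
  apply: le_measure; rewrite ?inE//; first exact: measurableI.
  move=> x; rewrite /A /B /= in_itv /= => -[Jx Ix].
  have := @ge_inf _ _ infJ.2 _ Jx; have := @ub_le_sup _ _ supI.2 _ Ix.
  by move=> ? ?; apply/andP; split; lra.
rewrite lebesgue_measure_itv /=; case: ifP => _; last by rewrite lee_fin ltW.
rewrite -EFinD lee_fin; lra.
Qed.

Lemma measurable_undergraph (f : RR -> R) : measurable_fun setT f ->
  measurable [set p : RR * RR | 0 <= p.2 /\ p.2 < f p.1]%R.
Proof.
move=> mf; rewrite (_ : mkset _ = snd @^-1` `[0%R, +oo[%classic `&`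
    (fun p : RR * RR => (p.2 < f p.1)%R) @^-1` [set true]); last first.
  by apply/seteqP; split => x /=; rewrite in_itv /= andbT.
apply: measurableI; first exact: measurable_preimage measurable_snd _.
have := @measurable_fun_ltr _ _ _ setT (fun p : RR * RR => p.2) (fun p => f p.1)
  (measurable_snd) (measurableT_comp mf measurable_fst) measurableT [set true].
by rewrite setTI; exact.
Qed.

(** The area under the graph, sliced vertically and horizontally; the condition 0 <= t removes the
    negative levels. *)
Lemma layer_cake (f : RR -> R) : measurable_fun setT f -> (forall x, 0 <= f x)%R ->
  \int[mu]_x (f x)%:E = \int[mu]_t mu [set x | 0 <= t /\ t < f x]%R.
Proof.
move=> mf f0.
rewrite -(@product_measure_swap _ _ _ _ _ mu mu _ (measurable_undergraph mf)).
apply: eq_integral => x _; rewrite (_ : mkset _ = `[0%R, f x[%classic).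
  rewrite -[RHS]/(mu `[0%R, f x[%classic) lebesgue_measure_itv /= lte_fin.
  case: ltgtP (f0 x) => // [_ _|<- _].
    by rewrite sube0.
  by [].
by apply/seteqP; split => t /=; rewrite in_itv /= => /andP.
Qed.

Lemma measurable_gt (f : RR -> R) t : measurable_fun setT f -> measurable [set x | t < f x]%R.
Proof.
move=> mf; rewrite (_ : mkset _ = f @^-1` `]t, +oo[%classic).
  by apply: measurable_preimage.
by apply/seteqP; split => x /=; rewrite in_itv /= andbT.
Qed.

(* Applies [lebesgue_measure_midpoint] to the superlevel sets, which are nonempty
   for the same levels because f and g have the same supremum. *)
Lemma prekopa_leindler_normalized (b : R) (f g h : RR -> R) :
  measurable_fun setT f -> measurable_fun setT g -> measurable_fun setT h ->
  (forall x, 0 <= f x <= 1)%R -> (forall x, 0 <= g x <= 1)%R -> (forall x, 0 <= h x)%R ->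
  (forall x, f x != 0 -> `|x| <= b)%R -> (forall x, g x != 0 -> `|x| <= b)%R ->
  (forall t, t < 1 -> exists x, t < f x)%R -> (forall t, t < 1 -> exists x, t < g x)%R ->
  (forall x y, f x * g y <= h (2^-1 * (x + y)) ^+ 2)%R ->
  \int[mu]_x (f x)%:E + \int[mu]_x (g x)%:E <= 2%:E * \int[mu]_x (h x)%:E.
Proof.
move=> mf mg mh f01 g01 h0 fb gb f1 g1 fgh.
have f0 x : (0 <= f x)%R by case/andP: (f01 x).
have g0 x : (0 <= g x)%R by case/andP: (g01 x).
have msect k : measurable_fun setT k ->
    measurable_fun setT (fun t : RR => mu [set x | 0 <= t /\ t < k x]%R).
  move=> mk; have := @measurable_fun_ysection _ _ _ _ _ mu _ (measurable_undergraph mk).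
  apply: eq_measurable_fun => t _ /=; congr (mu _).
  by apply/seteqP; split => x; rewrite /ysection /= inE.
rewrite !layer_cake// -ge0_integralD//; try exact: msect.
rewrite -ge0_integralZl//; last exact: msect.
apply: ge0_le_integral => //.
- by move=> t _; rewrite adde_ge0.
- by apply: emeasurable_funD; exact: msect.
- by apply: measurable_funeM; exact: msect.
move=> t _ /=; case: (boolP (t < 0)%R) => [t0|]; last rewrite -leNgt => t0.
  have e0 (k : RR -> R) : [set x : RR | 0 <= t /\ t < k x]%R = set0.
    by apply/seteqP; split => // x [] /=; rewrite leNgt t0.
  by rewrite !e0 measure0 adde0 mule0.
have [t1|t1] := ltP t 1%R; last first.
  rewrite [X in mu X + _](_ : mkset _ = set0); last first.
    apply/seteqP; split => // x [_] /=.
    by case/andP: (f01 x) => _ fx1; rewrite ltNge (le_trans fx1).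
  rewrite [X in _ + mu X <= _](_ : mkset _ = set0); last first.
    apply/seteqP; split => // x [_] /=.
    by case/andP: (g01 x) => _ gx1; rewrite ltNge (le_trans gx1).
  by rewrite measure0 add0e mule_ge0.
have sE (k : RR -> R) : [set x : RR | 0 <= t /\ t < k x]%R = [set x | t < k x]%R.
  by apply/seteqP; split => x /= => [[]|].
rewrite !sE; apply: (@lebesgue_measure_midpoint b).
- exact: measurable_gt.
- exact: measurable_gt.
- exact: measurable_gt.
- by have [x fx] := f1 _ t1; exists x.
- by have [x gx] := g1 _ t1; exists x.
- by move=> x /= tx; apply: fb; rewrite gt_eqF// (le_lt_trans t0).
- by move=> x /= tx; apply: gb; rewrite gt_eqF// (le_lt_trans t0).
(* Two values above t >= 0 have a product above t^2, so [h] exceeds t at the midpoint. *)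
move=> x y /= tx ty; rewrite -(@ltr_sqr _ t) ?nnegrE//.
apply: lt_le_trans (fgh x y); rewrite expr2.
exact: ltr_pM.
Qed.

(** The arithmetic-geometric mean inequality 4ab <= (a + b)^2; an infinite [c] makes the bound
    trivial. *)
Lemma mule_le_sqr_half (a b c : \bar R) : 0 <= a -> 0 <= b -> 0 <= c ->
  a + b <= 2%:E * c -> a * b <= c * c.
Proof.
move: c => [c||]//; last first.
  by move=> *; rewrite mulyy leey.
move: a b => [a||]// [b||]//; rewrite -!EFinM -!EFinD !lee_fin => a0 b0 c0 abc.
have := sqr_ge0 (a - b)%R => h; nra.
Qed.

(** Divide [f] and [g] by their suprema [F] and [G], and [h] by the geometric mean of [F] and [G]:
    the hypothesis is preserved, and the normalized additive inequality yields the product form by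
    [mule_le_sqr_half]. If [f] or [g] vanishes identically, the left side is zero. *)
Lemma prekopa_leindler (b C : R) (f g h : RR -> R) :
  measurable_fun setT f -> measurable_fun setT g -> measurable_fun setT h ->
  (forall x, 0 <= f x <= C)%R -> (forall x, 0 <= g x <= C)%R -> (forall x, 0 <= h x)%R ->
  (forall x, f x != 0 -> `|x| <= b)%R -> (forall x, g x != 0 -> `|x| <= b)%R ->
  (forall x y, f x * g y <= h (2^-1 * (x + y)) ^+ 2)%R ->
  (\int[mu]_x (f x)%:E) * (\int[mu]_x (g x)%:E) <=
  (\int[mu]_x (h x)%:E) * (\int[mu]_x (h x)%:E).
Proof.
move=> mf mg mh f0C g0C h0 fb gb fgh.
have ge0P k : (forall x, 0 <= k x <= C)%R -> (exists F, [/\ 0 < F, (forall x, k x <= F) &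
    forall t, t < 1 -> exists x, t < F^-1 * k x])%R \/ \int[mu]_x (k x)%:E = 0.
  move=> k0C; have [[x kx0]|k0] := pselect (exists x, (0 < k x)%R); last first.
    right; apply: integral0_eq => x _; congr EFin; apply/eqP; rewrite eq_le.
    case/andP: (k0C x) => -> _; rewrite andbT leNgt; apply/negP => kx.
    by apply: k0; exists x.
  left; have hk : has_sup (range k).
    by split; [exists (k x), x|exists C => _ [y _ <-]; case/andP: (k0C y)].
  have kF y : (k y <= sup (range k))%R by apply: ub_le_sup hk.2 _ _; exists y.
  have F0 : (0 < sup (range k))%R by exact: lt_le_trans (kF x).
  exists (sup (range k)); split => // t t1.
  have e0 : (0 < sup (range k) * (1 - t))%R by rewrite mulr_gt0// subr_gt0.
  have [_ [y _ <-] yt] := sup_adherent e0 hk.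
  exists y; rewrite mulrC ltr_pdivlMr//; apply: le_lt_trans yt; lra.
have int_ge0 (k : RR -> R) : (forall x, 0 <= k x)%R -> 0 <= \int[mu]_x (k x)%:E.
  by move=> k0; apply: integral_ge0 => x _; rewrite lee_fin.
have [[F [F0 fF F1]]|->] := ge0P _ f0C; last by rewrite mul0e mule_ge0// int_ge0.
have [[G [G0 gG G1]]|->] := ge0P _ g0C; last by rewrite mule0 mule_ge0// int_ge0.
pose H := Num.sqrt (F * G).
have H0 : (0 < H)%R by rewrite sqrtr_gt0 mulr_gt0.
have HH : (H * H = F * G)%R by rewrite -expr2 sqr_sqrtr// mulr_ge0// ltW.
have scaled (k : RR -> R) (K : R) : measurable_fun setT k -> (forall x, 0 <= k x)%R ->
    (0 < K)%R -> \int[mu]_x (k x)%:E = K%:E * \int[mu]_x (K^-1 * k x)%:E.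
  move=> mk k0 K0; rewrite -ge0_integralZl_EFin ?ltW//.
  - by apply: eq_integral => x _; rewrite -EFinM mulVKf// gt_eqF.
  - by move=> x _; rewrite lee_fin mulr_ge0 ?invr_ge0// ltW.
  - by apply/measurable_EFinP; exact: measurable_funM.
have f0 x : (0 <= f x)%R by case/andP: (f0C x).
have g0 x : (0 <= g x)%R by case/andP: (g0C x).
rewrite (scaled f F)// (scaled g G)// (scaled h H)// muleACA [leRHS]muleACA -!EFinM HH.
rewrite lee_pmul2l ?fin_numE ?lte_fin ?mulr_gt0//.
have F0' := ltW F0; have G0' := ltW G0; have H0' := ltW H0.
apply: mule_le_sqr_half; try by apply: int_ge0 => x; rewrite mulr_ge0 ?invr_ge0.
apply: (@prekopa_leindler_normalized b) => //; try exact: measurable_funM.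
- by move=> x; rewrite mulr_ge0 ?invr_ge0//= ler_pdivrMl// mulr1.
- by move=> x; rewrite mulr_ge0 ?invr_ge0//= ler_pdivrMl// mulr1.
- by move=> x; rewrite mulr_ge0 ?invr_ge0.
- by move=> x; rewrite mulf_eq0 negb_or => /andP[_]; exact: fb.
- by move=> x; rewrite mulf_eq0 negb_or => /andP[_]; exact: gb.
move=> x y; rewrite mulrACA -invfM exprMn exprVn [(H ^+ 2)%R]expr2 HH.
by rewrite ler_pM2l ?invr_gt0 ?mulr_gt0.
Qed.

(** Multiplicative Brunn-Minkowski inequality. The section of [M] at (s + t)/2 contains the
    midpoints of the sections of [K] at s and of [L] at t, so the induction hypothesis gives the
    pointwise inequality for [prekopa_leindler]. The common bound [b] makes the section volumes
    finite and boundedly supported. *)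
Lemma lebesgue_rV_midpoint n (b : R) (K L M : set 'rV[R]_n) :
  measurable K -> measurable L -> measurable M ->
  (forall x i, K x -> `|x 0%R i| <= b)%R -> (forall x i, L x -> `|x 0%R i| <= b)%R ->
  (forall x i, M x -> `|x 0%R i| <= b)%R ->
  (forall x y, K x -> L y -> M (2^-1 *: (x + y))%R) ->
  lebesgue_rV K * lebesgue_rV L <= lebesgue_rV M * lebesgue_rV M.
Proof.
elim: n K L M => [|n IH] K L M mK mL mM Kb Lb Mb KLM.
  (* In dimension zero there is a single vector, so a nonempty set is the whole space. *)
  have [->|/set0P[x Kx]] := eqVneq K set0; first by rewrite measure0 mul0e mule_ge0.
  have [->|/set0P[y Ly]] := eqVneq L set0; first by rewrite measure0 mule0 mule_ge0.
  have full (E : set 'rV[R]_0) z : E z -> E = setT.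
    by move=> Ez; apply/seteqP; split => // t _; rewrite (thinmx0 t) -(thinmx0 z).
  by rewrite (full K x)// (full L y)// (full M _ (KLM _ _ Kx Ly)).
pose box : set 'rV[R]_n := [set x | forall i, `[(- b)%R, b]%classic (x 0%R i)].
have mbox : measurable box by exact: (@measurable_box _ _ (fun=> `[(- b)%R, b]%classic)).
have boxfin : lebesgue_rV box < +oo.
  rewrite (@lebesgue_rV_box _ _ (fun=> `[(- b)%R, b]%classic))//.
  have [r ->] : exists r, mu `[(- b)%R, b]%classic = r%:E.
    by rewrite lebesgue_measure_itv /=; case: ifP => _; eexists; rewrite -?EFinD.
  by rewrite prodEFin ltry.
pose sec (E : set 'rV[R]_n.+1) s := [set y | E (rV_cons s y)].
have msec E s : measurable E -> measurable (sec E s) by exact: measurable_rV_section.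
have secb (E : set 'rV[R]_n.+1) s y i :
    (forall x i, E x -> `|x 0%R i| <= b)%R -> sec E s y -> (`|y 0%R i| <= b)%R.
  by move=> Eb /(Eb _ (lift ord0 i)); rewrite rV_consS.
have secbox (E : set 'rV[R]_n.+1) s :
    (forall x i, E x -> `|x 0%R i| <= b)%R -> sec E s `<=` box.
  by move=> Eb y Ey i /=; rewrite in_itv /= -ler_norml; exact: (secb E s y i Eb Ey).
have secfin (E : set 'rV[R]_n.+1) s : measurable E -> (forall x i, E x -> `|x 0%R i| <= b)%R ->
    lebesgue_rV (sec E s) \is a fin_num.
  move=> mE Eb; rewrite ge0_fin_numE//; apply: le_lt_trans boxfin.
  by apply: le_measure; rewrite ?inE//; [exact: msec|exact: (secbox E s Eb)].
pose f E s := fine (lebesgue_rV (sec E s)).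
have mf (E : set 'rV[R]_n.+1) : measurable E -> measurable_fun setT (f E : RR -> R).
  by move=> mE; apply: measurableT_comp => //; exact: measurable_fun_rV_section.
have intf (E : set 'rV[R]_n.+1) : measurable E -> (forall x i, E x -> `|x 0%R i| <= b)%R ->
    lebesgue_rV E = \int[mu]_s (f E s)%:E.
  move=> mE Eb; rewrite lebesgue_rVSE; apply: eq_integral => s _.
  by rewrite fineK//; exact: secfin.
have f0 (E : set 'rV[R]_n.+1) s : (0 <= f E s)%R by exact: fine_ge0.
have fC (E : set 'rV[R]_n.+1) s : measurable E -> (forall x i, E x -> `|x 0%R i| <= b)%R ->
    (0 <= f E s <= fine (lebesgue_rV box))%R.
  move=> mE Eb; rewrite f0 /= fine_le//; first exact: secfin.
    by rewrite ge0_fin_numE.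
  by apply: le_measure; rewrite ?inE//; [exact: msec|exact: (secbox E s Eb)].
have fb (E : set 'rV[R]_n.+1) s :
    (forall x i, E x -> `|x 0%R i| <= b)%R -> (f E s != 0 -> `|s| <= b)%R.
  move=> Eb; apply: contraR => sb; rewrite /f (_ : sec E s = set0) ?measure0//.
  apply/seteqP; split => // y /(Eb _ ord0); rewrite rV_cons0.
  by move/negP: sb.
rewrite (intf K)// (intf L)// (intf M)//.
apply: (@prekopa_leindler b (fine (lebesgue_rV box))) => //.
- exact: mf.
- exact: mf.
- exact: mf.
- by move=> s; exact: fC.
- by move=> s; exact: fC.
- by move=> s; exact: fb.
- by move=> s; exact: fb.
move=> s t; rewrite -lee_fin expr2 !EFinM !fineK; try exact: secfin.
apply: IH; try exact: msec.
- by move=> x i; exact: (secb _ _ _ _ Kb).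
- by move=> x i; exact: (secb _ _ _ _ Lb).
- by move=> x i; exact: (secb _ _ _ _ Mb).
move=> x y Kx Ly; have := KLM _ _ Kx Ly; rewrite /sec /=; congr M.
apply/rowP => i; rewrite mxE [X in (_ * X)%R]mxE.
case: (unliftP ord0 i) => [j|] ->; last by rewrite !rV_cons0.
by rewrite !rV_consS !mxE.
Qed.

End brunn_minkowski.

(** * The Rogers-Shephard inequality *)

Section rogers_shephard.
Context {R : realType}.
Local Notation RR := (measurableTypeR R).
Local Notation mu := (@lebesgue_measure R).
Local Open Scope ereal_scope.

(** Convexity with a plain real coefficient, in place of the bundled elements of [0, 1] in
    [convex_set]. *)
Definition stable_comb (V : lmodType R) (K : set V) : Prop :=
  forall x y (t : R), (0 <= t <= 1)%R -> K x -> K y -> K (t *: x + (1 - t) *: y)%R.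

Lemma convex_set_stable_comb n (A : set 'rV[R]_n) : convex_set A -> stable_comb A.
Proof.
move=> cA x y t /andP[t0 t1] /mem_set Ax /mem_set Ay.
pose l : {i01 R} := @Itv01 R t t0 t1.
by have := cA x y l Ax Ay; rewrite inE.
Qed.

Definition diff_body (V : zmodType) (K : set V) : set V :=
  [set x | exists a b, [/\ K a, K b & x = (a - b)%R]].

Lemma compact_diff_body n (K : set 'rV[R]_n) : compact K -> compact (diff_body K).
Proof.
move=> cK; rewrite (_ : diff_body K = (fun p => p.1 - p.2)%R @` (K `*` K)); last first.
  apply/seteqP; split => x /=; first by move=> [a [b [Ka Kb ->]]]; exists (a, b).
  by move=> [[a b] /= [Ka Kb] <-]; exists a, b.
apply: continuous_compact; last exact: compact_setX.
apply: continuous_subspaceT => p; apply: cvgB.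
  exact: cvg_fst.
exact: cvg_snd.
Qed.

Lemma compact_coord_bounded n (K : set 'rV[R]_n) : compact K ->
  exists b : R, forall x i, K x -> (`|x 0 i| <= b)%R.
Proof.
move=> /(@compact_bounded R 'rV[R]_n) [M [_ KM]]; exists (M + 1)%R => x i Kx.
have M1 : (M < M + 1)%R by rewrite ltrDl.
apply: le_trans (KM _ M1 x Kx).
by rewrite [leRHS]/Num.norm /= mx_normrE; apply/bigmax_geP; right => /=; exists (0%R, i).
Qed.

Lemma lebesgue_rV_compact_fin n (K : set 'rV[R]_n) : compact K ->
  lebesgue_rV K \is a fin_num.
Proof.
move=> cK; have [b Kb] := compact_coord_bounded cK.
rewrite ge0_fin_numE//; pose I : set RR := `[(- b)%R, b]%classic.
have mI : measurable I by exact: measurable_itv.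
apply: (@le_lt_trans _ _ (lebesgue_rV [set x : 'rV[R]_n | forall i, I (x 0%R i)])).
  have mbox := @measurable_box R n (fun=> I) (fun=> mI).
  have mK := compact_measurable_rV cK.
  apply: le_measure; rewrite ?inE//.
  by move=> x Kx i; rewrite /I /= in_itv /= -ler_norml; exact: Kb.
rewrite (@lebesgue_rV_box _ _ (fun=> I))//.
have [r ->] : exists r, mu I = r%:E.
  by rewrite lebesgue_measure_itv /=; case: ifP => _; eexists; rewrite -?EFinD.
by rewrite prodEFin ltry.
Qed.

Lemma lebesgue_rV_affine n (c : R) (a : 'rV[R]_n) (E : set 'rV[R]_n) :
  (0 < c)%R -> measurable E ->
  lebesgue_rV [set x | E (c^-1 *: (x - a))%R] = (c ^+ n)%:E * lebesgue_rV E.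
Proof.
move=> c0 mE; rewrite -lebesgue_rV_scale//.
rewrite -(@lebesgue_rV_shift _ _ (- a)%R [set x | E (c^-1 *: x)%R])//.
exact: measurable_preimage (@measurable_scale R n c^-1) mE.
Qed.

(** Brunn-Minkowski for K and -K, which have equal volume: their midpoints form [M], the difference
    body scaled by 1/2, so |K|^2 <= |M|^2. *)
Lemma lebesgue_rV_diff_body_ge n (K : set 'rV[R]_n) : compact K ->
  lebesgue_rV K <= (2 ^- n)%:E * lebesgue_rV (diff_body K).
Proof.
move=> cK; have cD := compact_diff_body cK.
have mK := compact_measurable_rV cK; have mD := compact_measurable_rV cD.
have [b Kb] := compact_coord_bounded cK.
pose M := [set x | diff_body K ((2^-1)^-1 *: x)%R].
have mM : measurable M by exact: measurable_preimage (@measurable_scale R n _) mD.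
pose N := [set x | K (- x)%R].
have mN : measurable N by exact: measurable_preimage (@measurable_oppr_rV R n) mK.
have MN x i : M x -> (`|x 0 i| <= b)%R.
  move=> [u [v [Ku Kv /(congr1 (fun z : 'rV_n => z 0%R i))]]]; rewrite invrK !mxE => e.
  have := Kb _ i Ku; have := Kb _ i Kv; rewrite !ler_norml => /andP[? ?] /andP[? ?].
  by apply/andP; split; lra.
have := @lebesgue_rV_midpoint R n b K N M mK mN mM Kb _ MN.
rewrite (lebesgue_rVN mK) => KM.
have {KM} : lebesgue_rV K * lebesgue_rV K <= lebesgue_rV M * lebesgue_rV M.
  apply: KM; first by move=> x i /(Kb _ i); rewrite mxE normrN.
  move=> x y Kx Ny; exists x, (- y)%R; split => //.
  by rewrite invrK scalerA divff// scale1r opprK.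
rewrite -exprVn /M lebesgue_rV_scale ?invr_gt0//.
have := lebesgue_rV_compact_fin cK; have := lebesgue_rV_compact_fin cD.
have : 0 <= lebesgue_rV K by exact: measure_ge0.
have : 0 <= lebesgue_rV (diff_body K) by exact: measure_ge0.
move: (lebesgue_rV K) (lebesgue_rV (diff_body K)) => [k||]// [d||]// d0 k0 _ _.
move: d0 k0; rewrite -!EFinM !lee_fin => d0 k0 kd.
have m0 : (0 <= 2^-1 ^+ n * d)%R by rewrite mulr_ge0// exprn_ge0.
by rewrite -ler_sqr ?nnegrE// [(k ^+ 2)%R]expr2 [leRHS]expr2.
Qed.

(* The intersection contains (1 - t)K + ta. *)
Lemma lebesgue_rV_inter_shift_ge n (K : set 'rV[R]_n) (a b : 'rV[R]_n) (t : R) :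
  measurable K -> stable_comb K -> K a -> K b -> (0 <= t < 1)%R ->
  ((1 - t) ^+ n)%:E * lebesgue_rV K <=
  lebesgue_rV [set y | K y /\ K (y - t *: (a - b))%R].
Proof.
move=> mK cK Ka Kb /andP[t0 t1].
have t1' : (0 < 1 - t)%R by rewrite subr_gt0.
rewrite -(lebesgue_rV_affine (t *: a) t1' mK).
have maff (c : R) (v : 'rV[R]_n) : measurable [set y | K (c *: (y - v))%R].
  apply: (measurable_preimage (f := fun y : 'rV[R]_n => c *: (y - v))%R) mK.
  by apply: measurableT_comp (@measurable_scale R n c) _; exact: measurable_fun_rVD.
apply: le_measure; rewrite ?inE//.
  apply: measurableI => //; have := maff 1%R (t *: (a - b))%R.
  by congr measurable; apply/seteqP; split => y /=; rewrite scale1r.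
move=> y /= Ky.
(* Put z = (y - ta)/(1 - t), a point of [K]. Taking [c] to be a shows y as a combination of a and z;
   taking it to be b shows y - t(a - b) as one of b and z. *)
have e c : (y - t *: a + t *: c = t *: c + (1 - t) *: ((1 - t)^-1 *: (y - t *: a)))%R.
  by rewrite scalerA divff ?gt_eqF// scale1r addrC.
have t01 : (0 <= t <= 1)%R by rewrite t0 ltW.
split; first by have := cK _ _ _ t01 Ka Ky; rewrite -e subrK.
by have := cK _ _ _ t01 Kb Ky; rewrite -e scalerBr opprB addrA addrAC.
Qed.

(** The integral of the covariogram: for each y in [K], the x with y - x in [K] form a reflected
    translate of [K]. *)
Lemma integral_inter_shift n (K : set 'rV[R]_n) : measurable K ->
  \int[@lebesgue_rV R n]_x lebesgue_rV [set y | K y /\ K (y - x)%R] =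
  lebesgue_rV K * lebesgue_rV K.
Proof.
move=> mK.
rewrite (@product_measure_swap _ _ _ _ _ (@lebesgue_rV R n) (@lebesgue_rV R n)
  [set p | K p.2 /\ K (p.2 - p.1)%R]); last first.
  apply: measurableI; first exact: measurable_preimage measurable_snd mK.
  apply: (measurable_preimage (f := fun p : 'rV[R]_n * 'rV[R]_n => p.2 - p.1)%R) mK.
  apply: measurable_fun_rVD => //; exact: measurableT_comp (@measurable_oppr_rV R n) _.
apply: (@integral_measure_and R _ _ (@lebesgue_rV R n) _ _ (@lebesgue_rV R n) K
   (fun y => [set x | K (y - x)%R])) => // y _.
rewrite -[RHS](lebesgue_rVN mK) -[RHS](lebesgue_rV_shift (- y)%R).
  by congr lebesgue_rV; apply/seteqP; split => x /=; rewrite opprB.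
exact: measurable_preimage (@measurable_oppr_rV R n) mK.
Qed.

(** The weight whose integral over [r, 1] is (1 - r)^(m+1). *)
Definition onem_density m (t : R) : R := (m.+1%:R * t.~ ^+ m)%R.

Lemma measurable_onem_density d (T : measurableType d) m (A : set T) (f : T -> R) :
  measurable_fun A f -> measurable_fun A (fun t => onem_density m (f t)).
Proof.
move=> mf; apply: measurable_funM => //; apply: measurable_funX.
exact: measurable_funB.
Qed.

Lemma integral_onem_density m (r : R) : (r < 1)%R ->
  \int[mu]_(t in `[r, 1%R]) (onem_density m t)%:E = (r.~ ^+ m.+1)%:E.
Proof.
move=> r1; rewrite (@continuous_FTC2 _ _ (fun x => x.~ ^+ m.+1 * -1)%R)//.
- rewrite onem1 expr0n /= mul0r -EFinD; congr EFin; ring.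
- apply: continuous_in_subspaceT => x _.
  by apply: cvgM; [exact: cvg_cst|exact: continuous_onemXn].
- split.
  + by move=> y _; apply: derivableM => //=; exact: onemXn_derivable.
  + apply: cvg_at_right_filter; apply: cvgM; last exact: cvg_cst.
    exact: continuous_onemXn.
  + apply: cvg_at_left_filter; apply: cvgM; last exact: cvg_cst.
    exact: continuous_onemXn.
- move=> x _; rewrite derive1Mr//; last exact: onemXn_derivable.
  by rewrite derive_onemXn /= /onem_density; ring.
Qed.

(** With p the (m+1)-th root of [c], the set [T] lies in [1 - p, 1], over which the weight has
    integral p^(m+1) = c. *)
Lemma integral_onem_density_le m (c : R) (T : set RR) : measurable T ->
  (0 <= c <= 1)%R -> (forall t, T t -> 0 < t <= 1 /\ t.~ ^+ m.+1 <= c)%R ->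
  \int[mu]_(t in T) (onem_density m t)%:E <= c%:E.
Proof.
move=> mT /andP[c0 c1] Tc.
pose p := powR c (m.+1%:R^-1).
have pc : (p ^+ m.+1 = c)%R.
  by rewrite -powR_mulrn ?powR_ge0// /p -powRrM mulVf ?pnatr_eq0// powRr1.
have p0 : (0 <= p)%R by exact: powR_ge0.
have w0 t : (p.~ <= t <= 1)%R -> (0 <= onem_density m t)%R.
  by move=> /andP[_ t1]; rewrite mulr_ge0// exprn_ge0// subr_ge0.
apply: (@le_trans _ _ (\int[mu]_(t in `[p.~, 1%R]) (onem_density m t)%:E)).
  apply: ge0_subset_integral => //.
    by apply/measurable_EFinP; exact: measurable_onem_density.
  move=> t /Tc[/andP[t0 t1] tc]; rewrite /= in_itv /= t1 andbT.
  have : (t.~ <= p)%R.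
    by rewrite -(@ler_pXn2r _ m.+1)// ?nnegrE ?subr_ge0// pc.
  by rewrite /onem; lra.
(* If 1 - p < 1 the integral is explicit; otherwise p = 0 and the interval is a single point. *)
have [p1|] := ltP (p.~) 1%R; first by rewrite integral_onem_density// onemK pc.
rewrite /onem => p1; have -> : p = 0%R by lra.
by rewrite subr0 set_itv1 integral_set1 lee_fin.
Qed.

(** The weight is integrated in both orders over the set [E] of pairs (x, t) with 0 < t <= 1 and x
    in tDK, where DK is the difference body. This gives (m+1) B(m+2, m+1) |DK| <= |K|, and the
    constant is (m+1)!^2 / (2m+2)!, the inverse of the binomial coefficient. *)
Lemma rogers_shephard m (K : set 'rV[R]_m.+1) : compact K -> stable_comb K ->
  0 < lebesgue_rV K ->
  ('C(2 * m.+1, m.+1)%:R^-1)%:E * lebesgue_rV (diff_body K) <= lebesgue_rV K.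
Proof.
move=> cK sK K0.
have cD := compact_diff_body cK.
have mK := compact_measurable_rV cK; have mD := compact_measurable_rV cD.
have Kfin := lebesgue_rV_compact_fin cK; have Dfin := lebesgue_rV_compact_fin cD.
pose k := fine (lebesgue_rV K); have kE : lebesgue_rV K = k%:E by rewrite fineK.
have k0 : (0 < k)%R by rewrite -lte_fin -kE.
pose G x := lebesgue_rV [set y | K y /\ K (y - x)%R].
have mS : measurable [set p : 'rV[R]_m.+1 * 'rV[R]_m.+1 | K p.2 /\ K (p.2 - p.1)%R].
  apply: measurableI; first exact: measurable_preimage measurable_snd mK.
  apply: (measurable_preimage (f := fun p : 'rV[R]_m.+1 * 'rV[R]_m.+1 => p.2 - p.1)%R) mK.
  apply: measurable_fun_rVD => //; exact: measurableT_comp (@measurable_oppr_rV R _) _.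
have mG : measurable_fun setT G.
  exact: (measurable_fun_section1 (@lebesgue_rV R m.+1) mS).
have GK x : G x <= lebesgue_rV K.
  by apply: le_measure; rewrite ?inE//; [exact: (measurable_section1 x mS)|move=> y []].
have G0 x : 0 <= G x by exact: measure_ge0.
have Gfin x : G x \is a fin_num.
  by rewrite ge0_fin_numE//; apply: le_lt_trans (GK x) _; rewrite kE ltry.
pose E : set ('rV[R]_m.+1 * RR) := [set p | (0 < p.2 <= 1)%R /\ diff_body K (p.2^-1 *: p.1)%R].
have mE : measurable E.
  have mI : measurable (`]0%R, 1%R] : set RR) by exact: measurable_itv.
  (* The inverse is written as the power -1, measurable by [measurable_powR]; both agree for t >
     0. *)
  pose F : set ('rV[R]_m.+1 * RR) := [set p | diff_body K (powR p.2 (-1) *: p.1)%R].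
  have -> : E = snd @^-1` `]0%R, 1%R]%classic `&` F.
    have e (p : 'rV[R]_m.+1 * RR) : (0 < p.2 <= 1)%R -> powR p.2 (-1) = (p.2^-1)%R.
      by move=> /andP[p0 _]; rewrite powR_inv1// ltW.
    by apply/seteqP; split => p /=; rewrite /E /F /= in_itv /= => -[p2]; rewrite e.
  apply: measurableI; first exact: measurable_preimage measurable_snd mI.
  apply: (measurable_preimage (f := fun p : 'rV[R]_m.+1 * RR => powR p.2 (-1) *: p.1)%R) mD.
  apply: measurable_fun_rV => i; under eq_fun do rewrite mxE.
  apply: measurable_funM.
    exact: (measurableT_comp (measurable_powR _) measurable_snd).
  exact: (measurableT_comp (measurable_coord i) measurable_fst).
pose w t := (onem_density m t)%:E.
pose f (p : 'rV[R]_m.+1 * RR) := w p.2 * (\1_E p)%:E.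
have w0 t : (t <= 1)%R -> 0 <= w t.
  by move=> t1; rewrite lee_fin mulr_ge0// exprn_ge0// subr_ge0.
have f0 p : 0 <= f p.
  rewrite /f indicE; have [|_] := boolP (p \in E); last by rewrite mule0.
  by rewrite mule1 inE => -[/andP[_ p1] _]; exact: w0.
have mf : measurable_fun setT f.
  apply: emeasurable_funM; apply/measurable_EFinP.
    exact: (measurable_onem_density m measurable_snd).
  exact: (measurable_indic mE).
(* If x lies in tDK, then (1 - t)^(m+1) <= G x / |K|, so these t have total weight at most G x /
   |K|. *)
have inner x : lebesgue_rV K * \int[mu]_t f (x, t) <= G x.
  have mEx : measurable [set t | E (x, t)] by exact: measurable_section1.
  rewrite (_ : \int[mu]_t f (x, t) = \int[mu]_(t in [set t | E (x, t)]) w t); last first.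
    rewrite [RHS]integral_mkcond; apply: eq_integral => t _.
    rewrite /f patchE indicE /=.
    have -> : (t \in [set t | E (x, t)]) = ((x, t) \in E).
      by apply/idP/idP; rewrite !inE.
    by case: ifP; rewrite ?mule1 ?mule0.
  have cG : G x = (k * (fine (G x) / k))%:E by rewrite mulrC divfK ?gt_eqF// fineK.
  have Gk0 : (0 <= fine (G x) / k)%R by apply: divr_ge0; [exact: fine_ge0|exact: ltW].
  rewrite kE cG EFinM lee_pmul2l//.
  apply: integral_onem_density_le => //.
    rewrite Gk0 ler_pdivrMr// mul1r.
    by rewrite -lee_fin (fineK (Gfin x)) -kE; exact: GK.
  move=> t [/= /andP[t0 t1] [a [b [Ka Kb xab]]]]; split; first by rewrite t0 t1.
  have [t1'|t1'] := ltP t 1%R; last first.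
    have -> : t = 1%R by apply: le_anti; rewrite t1.
    by rewrite onem1 expr0n.
  rewrite ler_pdivlMr// -lee_fin fineK// EFinM -kE.
  have -> : x = (t *: (a - b))%R by rewrite -xab scalerA divff ?gt_eqF// scale1r.
  by apply: lebesgue_rV_inter_shift_ge => //; rewrite ltW.
(* Integrate [inner] over x: the integral of [G] is |K|^2, and a factor |K| > 0 cancels. *)
have upper : \int[@lebesgue_rV R m.+1]_x \int[mu]_t f (x, t) <= lebesgue_rV K.
  have K0' := ltW K0.
  rewrite -(lee_pmul2l Kfin K0) -ge0_integralZl//; last 2 first.
  - exact: measurable_fun_fubini_tonelli_F.
  - by move=> x _; apply: integral_ge0 => t _.
  rewrite -(integral_inter_shift mK); apply: ge0_le_integral => //.
  - by move=> x _; rewrite mule_ge0// integral_ge0.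
  - by apply: measurable_funeM; exact: measurable_fun_fubini_tonelli_F.
apply: le_trans upper; rewrite fubini_tonelli//.
pose d := fine (lebesgue_rV (diff_body K)).
have dE : lebesgue_rV (diff_body K) = d%:E by rewrite fineK.
have d0 : (0 <= d)%R by rewrite fine_ge0.
(* For fixed t the section of [E] is tDK, of volume t^(m+1) |DK|; a Beta integral in t remains. *)
have -> : \int[mu]_t \int[@lebesgue_rV R m.+1]_x f (x, t) =
    (m.+1%:R * d)%:E * (beta_fun m.+2 m.+1)%:E.
  rewrite EFin_beta_fun -ge0_integralZl//; last 3 first.
  - apply/measurable_EFinP; apply/(measurable_restrictT _ _).1 => //.
    exact: measurable_XMonemX.
  - move=> t _; rewrite lee_fin patchE; case: ifPn => // t01.
    by apply: XMonemX_ge0; move: t01; rewrite inE.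
  - by rewrite lee_fin mulr_ge0.
  apply: eq_integral => t _.
  have [t01|t01] := boolP (0 < t <= 1)%R; last first.
    rewrite integral0_eq => [|x _]; last first.
      have NE : ~ E (x, t) by case=> /=; rewrite (negbTE t01).
      by rewrite /f indicE memNset// mule0.
    rewrite patchE; case: ifPn => [|_]; last by rewrite mule0.
    rewrite inE /= in_itv /= => /andP[t0 t1].
    (* The Beta integrand is supported on [0, 1] and [E] over ]0, 1]; at t = 0 the factor t^(m+1)
       vanishes. *)
    have -> : t = 0%R.
      by apply: le_anti; rewrite t0 andbT leNgt; apply: contra t01 => ->.
    by rewrite /XMonemX expr0n mul0r mule0.
  have /andP[t0 t1] := t01.
  have mEt : measurable [set x | E (x, t)].
    exact: (measurable_preimage (f := fun x : 'rV[R]_m.+1 => (x, t : RR))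
      (measurable_pair2 t) mE).
  rewrite (eq_integral (fun x => w t * (\1_[set x | E (x, t)] x)%:E)); last first.
    by move=> x _; rewrite /f !indicE /=; congr (_ * (_%:R)%:E); apply/idP/idP; rewrite !inE.
  rewrite ge0_integralZl//; last 2 first.
  - by apply/measurable_EFinP; exact: (measurable_indic mEt).
  - exact: w0.
  rewrite integral_indic// setIT.
  rewrite -[X in w t * X]/(@lebesgue_rV R m.+1 [set x | E (x, t)]).
  have -> : @lebesgue_rV R m.+1 [set x | E (x, t)] =
      (t ^+ m.+1)%:E * lebesgue_rV (diff_body K).
    rewrite -lebesgue_rV_scale//; congr lebesgue_rV.
    by apply/seteqP; split => x; rewrite /E /=; [case|split].
  rewrite dE patchE mem_set//=; last by rewrite in_itv /= ltW.
  rewrite /w -!EFinM; congr EFin; rewrite /onem_density /XMonemX; ring.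
rewrite beta_fun_fact -EFinM dE lee_fin.
rewrite le_eqVlt; apply/orP; left; apply/eqP.
have N2 : ((m.+1 + m).+1 = 2 * m.+1)%N by rewrite mul2n -addnn addnS.
have le2 : (m.+1 <= 2 * m.+1)%N by rewrite leq_pmull.
have := bin_fact le2; rewrite [X in (_ * (_ * (X - _)`!))%N]mul2n -addnn addnK.
rewrite N2 => <-; rewrite factS !natrM.
have c0 : ('C(2 * m.+1, m.+1)%:R != 0 :> R)%R by rewrite pnatr_eq0 -lt0n bin_gt0.
have f0' : (m`!%:R != 0 :> R)%R by rewrite pnatr_eq0 -lt0n fact_gt0.
by field; rewrite c0 f0' addrC natr1 pnatr_eq0.
Qed.

End rogers_shephard.

(** * The covariogram of a convex body *)

Section covariogram_convex.
Context {R : realType}.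
Local Notation RR := (measurableTypeR R).
Local Notation mu := (@lebesgue_measure R).

Lemma continuous_mulmx m n (Q : 'M[R]_(m, n)) : continuous (fun x : 'rV[R]_m => x *m Q).
Proof.
rewrite (_ : (fun x => _) = (fun x : 'rV[R]_m => \sum_k x 0 k *: row k Q)); last first.
  by apply/funext => x; rewrite mulmx_sum_row.
apply: continuous_big => [|k _ x]; first exact: add_continuous.
by apply: (@cvgZr_tmp _ _ _ (nbhs x)); exact: (@coord_continuous R 1 m 0 k x).
Qed.

(** The sup-norm ball contains the cube of side e / 2 with lowest corner [x]. *)
Lemma lebesgue_rV_ball_gt0 n (x : 'rV[R]_n) (e : R) (A : set 'rV[R]_n) : 0 < e ->
  ball x e `<=` A -> measurable A -> (0 < lebesgue_rV A)%E.
Proof.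
move=> e0 xA mA.
pose C := [set y : 'rV[R]_n | forall i, `[0, e / 2]%classic (y 0 i)].
have mC : measurable C by exact: (@measurable_box _ _ (fun=> `[0, e / 2]%classic)).
have CE : lebesgue_rV C = ((e / 2) ^+ n)%:E.
  by rewrite lebesgue_rV_cube// divr_ge0// ltW.
apply: (@lt_le_trans _ _ (lebesgue_rV C)).
  by rewrite CE lte_fin exprn_gt0// divr_gt0.
rewrite -(lebesgue_rV_shift (- x) mC).
apply: le_measure; rewrite ?inE//.
  apply: (measurable_preimage (f := fun y : 'rV[R]_n => y - x)) mC.
  exact: measurable_fun_rVD.
move=> y Cy; apply: xA; split => // i j; rewrite (ord1 i).
have := Cy j; rewrite /= !mxE in_itv /= => /andP[y0 y1].
rewrite /ball /= distrC ger0_norm// (le_lt_trans y1)// ltr_pdivrMr//.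
by rewrite ltr_pMr// ltr1n.
Qed.

Lemma covariogramE n (A : set 'rV[R]_n) x :
  covariogram A x = fine (lebesgue_rV [set y | A y /\ A (y - x)]).
Proof.
congr (fine (lebesgue_rV _)); apply/seteqP; split => y /=.
  by move=> [Ay [z Az zy]]; split => //; rewrite -zy addrK.
by move=> [Ay Ayx]; split => //; exists (y - x) => //; rewrite subrK.
Qed.

(** * Value at the origin and support of the covariogram *)

Section convex_body.
Variables (n : nat) (A : set 'rV[R]_n).
Hypotheses (cA : compact A) (sA : stable_comb A) (A0 : (0 < lebesgue_rV A)%E).

Let mA : measurable A := compact_measurable_rV cA.

Lemma measurable_inter_shift x : measurable [set y | A y /\ A (y - x)].
Proof.
apply: measurableI => //.
apply: (measurable_preimage (f := fun y : 'rV[R]_n => y - x)) mA.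
exact: measurable_fun_rVD.
Qed.

Lemma EFin_covariogram x :
  (covariogram A x)%:E = lebesgue_rV [set y | A y /\ A (y - x)].
Proof.
rewrite covariogramE fineK// ge0_fin_numE//.
apply: (@le_lt_trans _ _ (lebesgue_rV A)).
  apply: le_measure; rewrite ?inE//; first exact: measurable_inter_shift.
  by move=> y [].
by rewrite -ge0_fin_numE//; exact: lebesgue_rV_compact_fin.
Qed.

Lemma EFin_covariogram0 : (covariogram A 0)%:E = lebesgue_rV A.
Proof.
rewrite EFin_covariogram; congr lebesgue_rV.
by apply/seteqP; split => y /=; rewrite subr0 => // -[].
Qed.

(** The covariogram vanishes off the difference body, which is closed. Conversely, for x in it and
    small r > 0, the covariogram at (1 - r)x is at least r^n |A| > 0, and (1 - r)x tends to x. *)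
Lemma fsupp_covariogram : fsupp (covariogram A) = diff_body A.
Proof.
have cD := compact_diff_body cA.
have /closure_id DE : closed (diff_body A).
  by apply: compact_closed cD; exact: (@norm_hausdorff R 'rV[R]_n).
apply/seteqP; split.
  rewrite [X in _ `<=` X]DE; apply: closureS => x /= gx0.
  have [[y [Ay Ayx]]|E0] := pselect ([set y | A y /\ A (y - x)] !=set0).
    by exists y, (y - x); split => //; rewrite subKr.
  move/negP: gx0; case; rewrite covariogramE.
  rewrite (_ : mkset _ = set0) ?measure0//.
  by apply/seteqP; split => // y Ey; apply: E0; exists y.
move=> x [a [b [Aa Ab xab]]] B /nbhs_ballP[e /= e0 xeB].
(* Chosen so that both r < 1 and r |x| < e. *)
pose r := e / (e + `|x| + 1).
have d0 : 0 < e + `|x| + 1 by rewrite addr_gt0// ltr_wpDr.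
have r0 : 0 < r by rewrite divr_gt0.
have r1 : r < 1 by rewrite ltr_pdivrMr// mul1r -addrA ltrDl ltr_wpDl.
exists ((1 - r) *: x); split => /=.
  rewrite gt_eqF// -lte_fin EFin_covariogram xab.
  apply: lt_le_trans (lebesgue_rV_inter_shift_ge mA sA Aa Ab _).
    by rewrite mule_gt0// lte_fin exprn_gt0// subKr.
  by rewrite subr_ge0 ltW//= ltrBlDr ltrDl.
apply: xeB; rewrite -(@ball_normE R 'rV[R]_n) /=.
rewrite scalerBl scale1r subKr normrZ gtr0_norm// mulrAC ltr_pdivrMr//.
by rewrite ltr_pM2l// -addrA addrCA ltrDl ltr_wpDr.
Qed.

End convex_body.

(** * Orthonormal frames and translated intervals *)

Lemma frame_orthogonal n (u : 'rV[R]_n.+1) (V : 'M[R]_(n, n.+1)) :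
  unit_vector u -> orth_frame u V ->
  let Q : 'M[R]_n.+1 := col_mx u V in Q *m Q^T = 1%:M.
Proof.
move=> u1 [VV Vu] /=.
have uu : u *m u^T = 1%:M by rewrite -dotvE u1.
have uV : u *m V^T = 0 by rewrite -[LHS]trmxK trmx_mul trmxK Vu trmx0.
rewrite [_^T](@tr_col_mx _ 1 n).
apply: etrans (@mul_col_row _ 1 n _ 1 n _ _ _ _) _.
by rewrite uu VV Vu uV -(@scalar_mx_block _ 1 n).
Qed.

Lemma rV_cons_frame n (u : 'rV[R]_n.+1) (V : 'M[R]_(n, n.+1)) s y :
  rV_cons s y *m (col_mx u V : 'M[R]_n.+1) = s *: u + y *m V.
Proof.
by apply: etrans (@mul_row_col _ _ 1 n _ _ _ _ _) _; rewrite mul_scalar_mx.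
Qed.

(* Only the first stretch of length [h] of an interval escapes from it when
   translated by [-h]. *)
Lemma measure_escape_le (I : set RR) (h : R) : has_lbound I ->
  (forall a b x, I a -> I b -> a <= x <= b -> I x) -> 0 <= h ->
  measurable [set s | I s /\ ~ I (s - h)] ->
  (mu [set s | I s /\ ~ I (s - h)%R] <= h%:E)%E.
Proof.
move=> lI sI h0 mE; have [[s0 Is0]|I0] := pselect (I !=set0); last first.
  rewrite (_ : mkset _ = set0) ?measure0 ?lee_fin//.
  by apply/seteqP; split => // s [Is _]; apply: I0; exists s.
have infI : has_inf I by split => //; exists s0.
apply: (@le_trans _ _ (mu `[inf I, inf I + h]%classic)).
  apply: le_measure; rewrite ?inE//.
  move=> s [Is NIs] /=; rewrite in_itv /= ge_inf//= leNgt; apply/negP => hs.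
  have hs' : 0 < s - h - inf I by lra.
  have [i Ii] := inf_adherent hs' infI.
  rewrite addrC subrK => ish; apply: NIs; apply: (sI _ _ _ Ii Is).
  by rewrite ltW//= lerBlDr lerDl.
rewrite lebesgue_measure_itv /= lte_fin; case: ifP => _; last by rewrite lee_fin.
by rewrite -EFinD lee_fin addrC addrA (addrC (- _)) subrr add0r.
Qed.

(** The open stretch of length [h] after inf I lies in [I], because inf I + h <= s0 + h, and its
    translate by -h lies below inf I. *)
Lemma measure_escape_ge (I : set RR) (h s0 : R) : has_lbound I ->
  (forall a b x, I a -> I b -> a <= x <= b -> I x) -> 0 <= h ->
  measurable [set s | I s /\ ~ I (s - h)] -> I s0 -> I (s0 + h) ->
  (h%:E <= mu [set s | I s /\ ~ I (s - h)%R])%E.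
Proof.
move=> lI sI h0 mE Is0 Is0h.
have infI : has_inf I by split => //; exists s0.
apply: (@le_trans _ _ (mu `]inf I, inf I + h[%classic)); last first.
  apply: le_measure; rewrite ?inE//.
  move=> s /=; rewrite in_itv /= => /andP[s1 s2]; split; last first.
    by move=> /(ge_inf infI.2); rewrite leNgt => /negP; apply; lra.
  have hs' : 0 < s - inf I by lra.
  have [i Ii] := inf_adherent hs' infI.
  rewrite addrC subrK => iss; apply: (sI _ _ _ Ii Is0h).
  by rewrite ltW//= (le_trans (ltW s2))// lerD2r; exact: ge_inf infI.2 _ Is0.
rewrite lebesgue_measure_itv /= lte_fin; case: ltrP => hh.
  by rewrite -EFinD lee_fin; lra.
by rewrite lee_fin; lra.
Qed.

(** * Projection along [u] and the derivative of the covariogram at the origin *)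

Section frame.
Variables (n : nat) (A : set 'rV[R]_n.+1) (u : 'rV[R]_n.+1) (V : 'M[R]_(n, n.+1)).
Hypotheses (cA : compact A) (sA : stable_comb A) (A0 : (0 < lebesgue_rV A)%E).
Hypotheses (u1 : unit_vector u) (oV : orth_frame u V).

Let mA : measurable A := compact_measurable_rV cA.

Lemma measurable_frame : measurable_fun setT
  (fun p : RR * 'rV[R]_n => p.1 *: u + p.2 *m V).
Proof.
under eq_fun do rewrite -rV_cons_frame.
exact: measurableT_comp (measurable_mulmx _) (@measurable_rV_cons R n).
Qed.

(** Fubini along the lines parallel to [u]: the matrix with rows [u] and [V] is orthogonal and sends
    the first coordinate axis to the direction [u]. *)
Lemma lebesgue_rV_frame (E : set 'rV[R]_n.+1) : measurable E ->
  lebesgue_rV E = (\int[@lebesgue_rV R n]_y mu [set s | E (s *: u + y *m V)%R])%E.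
Proof.
move=> mE; rewrite -(lebesgue_rV_orthogonal (frame_orthogonal u1 oV) mE) lebesgue_rVSE.
rewrite -(@product_measure_swap _ _ _ _ _ mu (@lebesgue_rV R n)
  [set p : RR * 'rV[R]_n | E (p.1 *: u + p.2 *m V)]); last first.
  exact: measurable_preimage measurable_frame mE.
apply: eq_integral => s _; congr (lebesgue_rV _).
by apply/seteqP; split => y /=; rewrite rV_cons_frame.
Qed.

Lemma frame_mulmx_tr s y : (s *: u + y *m V) *m V^T = y.
Proof.
have [VV Vu] := oV; rewrite mulmxDl -mulmxA VV mulmx1 -scalemxAl.
have -> : u *m V^T = 0 by rewrite -[LHS]trmxK trmx_mul trmxK Vu trmx0.
by rewrite scaler0 add0r.
Qed.

Lemma dotv_frame s y : dotv (s *: u + y *m V) u = s.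
Proof.
have /matrixP/(_ 0 0) := dotvE (s *: u + y *m V) u.
rewrite mulmxDl -mulmxA oV.2 mulmx0 addr0 -scalemxAl -dotvE u1.
by rewrite !mxE eqxx !mulr1n mulr1.
Qed.

Lemma frame_decomp x : dotv x u *: u + (x *m V^T) *m V = x.
Proof.
pose Q : 'M[R]_n.+1 := col_mx u V.
have QQ : Q^T *m Q = 1%:M by apply: mulmx1C; exact: frame_orthogonal u1 oV.
rewrite -[RHS]mulmx1 -QQ mulmxA.
have -> : x *m Q^T = rV_cons (dotv x u) (x *m V^T).
  rewrite [Q^T](@tr_col_mx _ 1 n).
  by apply: etrans (@mul_mx_row _ _ _ 1 n _ _ _) _; rewrite -dotvE.
by rewrite rV_cons_frame.
Qed.

(** The orthogonal projection of [A] on the orthogonal of [u], in the coordinates given by the frame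
    [V]. *)
Definition shadow : set 'rV[R]_n := [set x *m V^T | x in A].

Lemma shadowE : shadow = [set y | exists s, A (s *: u + y *m V)].
Proof.
apply/seteqP; split => y /=.
  by move=> [x Ax <-]; exists (dotv x u); rewrite frame_decomp.
by move=> [s Asy]; exists (s *: u + y *m V) => //; rewrite frame_mulmx_tr.
Qed.

Lemma compact_shadow : compact shadow.
Proof.
apply: continuous_compact => //; apply: continuous_subspaceT; exact: continuous_mulmx.
Qed.

Lemma stable_comb_shadow : stable_comb shadow.
Proof.
move=> _ _ t t01 [x Ax <-] [y Ay <-]; exists (t *: x + (1 - t) *: y); first exact: sA.
by rewrite mulmxDl !scalemxAl.
Qed.

(** Over a null shadow, the lengths of the sections of [A] would integrate to zero. *)
Lemma shadow_gt0 : (0 < lebesgue_rV shadow)%E.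
Proof.
rewrite lt0e measure_ge0 andbT; apply/eqP => P0.
have mP := compact_measurable_rV compact_shadow.
have mf : measurable_fun setT (fun y => mu [set s | A (s *: u + y *m V)]).
  have mAp := measurable_preimage measurable_frame mA.
  have := measurable_fun_ysection mu mAp; apply: eq_measurable_fun => y _ /=.
  by congr (mu _); apply/seteqP; split => s; rewrite /ysection /= inE.
move: A0; rewrite (lebesgue_rV_frame mA).
rewrite (_ : integral _ _ _ =
    (\int[@lebesgue_rV R n]_(y in shadow) mu [set s | A (s *: u + y *m V)%R])%E).
  by rewrite null_set_integral ?ltxx//; exact: measurable_funS mf.
rewrite [RHS]integral_mkcond; apply: eq_integral => y _; rewrite patchE.
case: ifPn => // yP; rewrite (_ : mkset _ = set0) ?measure0//.
apply/seteqP; split => // s /= As; move/negP: yP; apply; rewrite inE shadowE.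
by exists s.
Qed.

Lemma section_convex y a b x : A (a *: u + y *m V) -> A (b *: u + y *m V) ->
  a <= x <= b -> A (x *: u + y *m V).
Proof.
move=> Aa Ab /andP[ax xb]; have [ab|ba] := ltP a b; last first.
  by have -> : x = a by lra.
pose t := (b - x) / (b - a).
have ba0 : 0 < b - a by lra.
have t01 : 0 <= t <= 1.
  by rewrite divr_ge0 ?subr_ge0 ?(ltW ab)//= ler_pdivrMr// mul1r lerB.
have := sA t01 Aa Ab; congr A.
rewrite !scalerDr !scalerA addrACA -!scalerDl addrC (addrC t) subrK scale1r addrC.
by congr (_ *: _ + _); rewrite /t; field; lra.
Qed.

Lemma section_lbound y : has_lbound [set s | A (s *: u + y *m V)].
Proof.
have [b Ab] := compact_coord_bounded cA.
exists (- \sum_i b * `|u 0 i|) => s /= As; rewrite -(dotv_frame s y) lerNl.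
rewrite /dotv -sumrN; apply: ler_sum => i _.
by rewrite (le_trans (ler_norm _))// normrN normrM ler_wpM2r// Ab.
Qed.

Let escape h := [set x | A x /\ ~ A (x - h *: u)].

Lemma measurable_escape h : measurable (escape h).
Proof.
apply: measurableI => //; apply: measurableC.
apply: (measurable_preimage (f := fun y : 'rV[R]_n.+1 => y - h *: u)) mA.
exact: measurable_fun_rVD.
Qed.

Lemma lebesgue_rV_escape h :
  lebesgue_rV (escape h) = (covariogram A 0 - covariogram A (h *: u))%:E.
Proof.
pose B := [set x | A (x - h *: u)].
have mB : measurable B.
  apply: (measurable_preimage (f := fun y : 'rV[R]_n.+1 => y - h *: u)) mA.
  exact: measurable_fun_rVD.
rewrite EFinB (EFin_covariogram0 cA) (EFin_covariogram cA).
rewrite [X in (X - _)%E](measureDI (@lebesgue_rV R n.+1) mA mB).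
rewrite -[X in (_ = _ + X - _)%E](EFin_covariogram cA) -(EFin_covariogram cA).
by rewrite addeK.
Qed.

Lemma escape_section h y : [set s | escape h (s *: u + y *m V)] =
  [set s | [set s | A (s *: u + y *m V)] s /\
     ~ [set s | A (s *: u + y *m V)] (s - h)].
Proof. by apply/seteqP; split => s; rewrite /escape /= scalerBl addrAC. Qed.

Lemma measurable_escape_section h y :
  measurable [set s : RR | escape h (s *: u + y *m V)].
Proof.
apply: (measurable_preimage (f := fun s : RR => s *: u + y *m V)) (measurable_escape h).
have mp : measurable_fun setT (fun s : RR => (s, y)) by exact: measurable_pair2.
exact: measurableT_comp measurable_frame mp.
Qed.

Lemma measurable_fun_escape h : measurable_fun setT
  (fun y => mu [set s : RR | escape h (s *: u + y *m V)]).
Proof.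
have mAp := measurable_preimage measurable_frame (measurable_escape h).
have := measurable_fun_ysection mu mAp; apply: eq_measurable_fun => y _ /=.
by congr (mu _); apply/seteqP; split => s; rewrite /ysection /= inE.
Qed.

(** Each line over the shadow meets [escape h] in length at most [h]; the other lines miss it. *)
Lemma covariogram_drop_le h : 0 <= h ->
  covariogram A 0 - covariogram A (h *: u) <= h * fine (lebesgue_rV shadow).
Proof.
move=> h0; rewrite -lee_fin -lebesgue_rV_escape (lebesgue_rV_frame (measurable_escape h)).
have mP := compact_measurable_rV compact_shadow.
rewrite EFinM fineK ?(lebesgue_rV_compact_fin compact_shadow)//.
rewrite -integral_cst//= [leRHS]integral_mkcond.
apply: ge0_le_integral => //.
- exact: measurable_fun_escape.
- by apply/(measurable_restrictT _ _).1.
move=> y _; rewrite patchE; case: ifPn => yP; last first.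
  rewrite (_ : mkset _ = set0) ?measure0//.
  apply/seteqP; split => // s /= [As _]; move/negP: yP; apply; rewrite inE shadowE.
  by exists s.
have mE := measurable_escape_section h y; rewrite escape_section in mE *.
apply: measure_escape_le => //; first exact: section_lbound.
by move=> a b x; exact: section_convex.
Qed.

(* The lines over the shadow contracted by [1 - h / c] towards the image of [x0]
   meet A in a segment of length at least [h]. *)
Lemma covariogram_drop_ge x0 c h : 0 < c -> A x0 -> A (x0 + c *: u) -> 0 < h < c ->
  h * ((1 - h / c) ^+ n * fine (lebesgue_rV shadow)) <=
  covariogram A 0 - covariogram A (h *: u).
Proof.
move=> c0 Ax0 Ax0c /andP[h0 hc].
have mP := compact_measurable_rV compact_shadow.
pose t := h / c.
have t0 : 0 < t by rewrite divr_gt0.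
have t1 : t < 1 by rewrite ltr_pdivrMr// mul1r.
have tc : t * c = h by rewrite divfK ?gt_eqF.
pose y0 := x0 *m V^T; pose s0 := dotv x0 u.
pose P' := [set y | shadow ((1 - t)^-1 *: (y - t *: y0))].
have mP' : measurable P'.
  apply: (measurable_preimage (f := fun y : 'rV[R]_n => (1 - t)^-1 *: (y - t *: y0))) mP.
  by apply: measurableT_comp (@measurable_scale R n _) _; exact: measurable_fun_rVD.
rewrite -lee_fin -lebesgue_rV_escape (lebesgue_rV_frame (measurable_escape h)).
rewrite !EFinM fineK ?(lebesgue_rV_compact_fin compact_shadow)//.
rewrite -(lebesgue_rV_affine (t *: y0))// ?subr_gt0//.
rewrite -/P' -integral_cst//= [leLHS]integral_mkcond.
apply: ge0_le_integral => //.
- by move=> y _; rewrite patchE; case: ifP => // _; rewrite lee_fin ltW.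
- by apply/(measurable_restrictT _ _).1.
- exact: measurable_fun_escape.
move=> y _; rewrite patchE; case: ifPn => yP; last exact: measure_ge0.
have mE := measurable_escape_section h y; rewrite escape_section in mE *.
move: yP; rewrite inE /P' /= shadowE => -[s1 As1].
have t01 : 0 <= t <= 1 by rewrite !ltW.
(* Combinations of x0 + au, with weight t, and of a point of [A], all lying over y. The values a = 0
   and a = c give two points of [A] at distance tc = h. *)
have e a : (t * (s0 + a) + (1 - t) * s1) *: u + y *m V =
    t *: (x0 + a *: u) + (1 - t) *: (s1 *: u + (1 - t)^-1 *: (y - t *: y0) *m V).
  set z := (1 - t)^-1 *: _.
  have yE : y = t *: y0 + (1 - t) *: z.
    by rewrite scalerA divff ?subr_eq0 ?gt_eqF// scale1r addrC subrK.
  rewrite -[X in X + a *: u](frame_decomp x0) -/s0 -/y0 [in LHS]yE.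
  rewrite mulmxDl -!scalemxAl; move: (y0 *m V) (z *m V) => Y Z.
  by apply/matrixP => i j; rewrite !mxE; ring.
apply: (@measure_escape_ge _ _ (t * (s0 + 0) + (1 - t) * s1)) => //.
- exact: section_lbound.
- by move=> a b x; exact: section_convex.
- exact: ltW.
- by rewrite /= e scale0r addr0; exact: sA.
rewrite /= (_ : _ + h = t * (s0 + c) + (1 - t) * s1); last by rewrite -tc; ring.
by rewrite e; exact: sA.
Qed.

(** The two bounds on the drop squeeze the quotient between -p and -(1 - h/c)^n p, where p is the
    volume of the shadow. *)
Lemma dir_quotient_covariogram_cvg x0 c : 0 < c -> A x0 -> A (x0 + c *: u) ->
  dir_quotient0 (covariogram A) u h @[h --> 0^'+] --> - fine (lebesgue_rV shadow).
Proof.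
move=> c0 Ax0 Ax0c; set p := fine _.
apply: (@squeeze_cvgr _ _ _ _ (fun=> - p) (fun h => - ((1 - h / c) ^+ n * p))).
- near=> h.
  have h0 : 0 < h by near: h; exact: nbhs_right_gt.
  have hc : h < c by near: h; exact: nbhs_right_lt.
  have := covariogram_drop_le (ltW h0).
  have := covariogram_drop_ge c0 Ax0 Ax0c (introT andP (conj h0 hc)).
  rewrite /dir_quotient0 ler_pdivrMr// ler_pdivlMr// -/p => lo up.
  by rewrite ![- _ * h]mulrC !mulrN; apply/andP; split; lra.
- exact: cvg_cst.
- have -> : - p = - ((1 - 0 / c) ^+ n * p) by rewrite mul0r subr0 expr1n mul1r.
  apply: cvg_at_right_filter; apply: cvgN; apply: cvgM; last exact: cvg_cst.
  apply: (@cvg_comp _ _ _ (fun h => 1 - h / c) (fun z => z ^+ n));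
    last exact: exprn_continuous.
  apply: cvgB; first exact: cvg_cst.
  by apply: cvgM; [exact: cvg_id|exact: cvg_cst].
Unshelve. all: by end_near. Qed.

(** Projection is linear, so it commutes with taking differences. *)
Lemma proj_orth_diff_body :
  [set y | proj_orth u (diff_body A) (y *m V)] = diff_body shadow.
Proof.
have [VV Vu] := oV.
have uV : u *m V^T = 0 by rewrite -[LHS]trmxK trmx_mul trmxK Vu trmx0.
apply/seteqP; split => y /=.
  move=> [_ [a [b [Aa Ab ->]]] yE]; exists (a *m V^T), (b *m V^T); split.
  - by exists a.
  - by exists b.
  by rewrite -[y]mulmx1 -VV mulmxA -yE mulmxBl -scalemxAl uV scaler0 subr0 mulmxBl.
move=> [_ [_ [[a Aa <-] [b Ab <-] ->]]]; exists (a - b); first by exists a, b.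
by rewrite -[in X in X - _](frame_decomp (a - b)) addrC addKr mulmxBl.
Qed.

End frame.

End covariogram_convex.

(** * The inequalities for the volume and for the directional derivative *)

Theorem proposition3p8 (R : realType) (n : nat) (n_ge2 : (2 <= n)%N)
    (A : set 'rV[R]_n) (A_regular : regclosed A) (A_compact : compact A)
    (A_convex : convex_set A) :
  (('C(2 * n, n)%:R^-1)%:E * lebesgue_rV (fsupp (covariogram A))
     <= (covariogram A 0)%:E
     <= (2 ^- n)%:E * lebesgue_rV (fsupp (covariogram A)))%E
  /\
  (forall u : 'rV[R]_n, unit_vector u ->
     cvg (dir_quotient0 (covariogram A) u h @[h --> 0^'+]) /\
     forall V : 'M[R]_(n.-1, n), orth_frame u V ->
       (('C(2 * n - 2, n - 1)%:R^-1)%:E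
          * lebesgue_hyperplane V (proj_orth u (fsupp (covariogram A)))
        <= (- dir_derivative0 (covariogram A) u)%:E
        <= (2 ^- (n - 1))%:E
          * lebesgue_hyperplane V (proj_orth u (fsupp (covariogram A))))%E).
Proof.
have sA := convex_set_stable_comb A_convex.
(* The empty set satisfies the hypotheses; the covariogram and all the volumes are then zero. *)
have [A0|/set0P[a Aa]] := eqVneq A set0.
  have g0 : covariogram A = cst 0.
    apply/funext => x; rewrite covariogramE (_ : mkset _ = set0) ?measure0//.
    by rewrite A0; apply/seteqP; split => // y [].
  have supp0 : fsupp (covariogram A) = set0.
    rewrite /fsupp g0 (_ : mkset _ = set0) ?closure0//.
    by apply/seteqP; split => // y; rewrite /= eqxx.
  have proj0 u V : @lebesgue_hyperplane R n V (proj_orth u set0) = 0%E.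
    rewrite /lebesgue_hyperplane (_ : mkset _ = set0) ?measure0//.
    by apply/seteqP; split => // y [].
  rewrite supp0 measure0 !mule0 g0 lexx; split => // u _.
  have -> : dir_quotient0 (cst 0) u = cst 0.
    by apply/funext => h; rewrite /dir_quotient0 subrr mul0r.
  split; first exact: is_cvg_cst.
  move=> V _; rewrite proj0 !mule0 /dir_derivative0.
  have -> : dir_quotient0 (cst 0) u = cst 0.
    by apply/funext => h; rewrite /dir_quotient0 subrr mul0r.
  by rewrite lim_cst// oppr0 lexx.
(* A point of [A] is in the closure of the interior by regularity, so the interior is nonempty. *)
have [x /nbhs_ballP[e /= e0 xeA]] : (interior A) !=set0.
  have : closure (interior A) a by rewrite A_regular.
  by move=> /(_ setT filterT)[x [Ax _]]; exists x.
have mA := compact_measurable_rV A_compact.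
have A0 := lebesgue_rV_ball_gt0 e0 xeA mA.
(* With n = m+2, both [A] and its shadow live in positive dimension, as [rogers_shephard]
   requires. *)
case: n n_ge2 A A_regular A_compact A_convex sA a Aa x xeA mA A0 => [//|[//|m]] _.
move=> A _ cA _ sA _ _ x xeA mA A0.
rewrite fsupp_covariogram// EFin_covariogram0//; split.
  by rewrite rogers_shephard//= lebesgue_rV_diff_body_ge.
move=> u u1.
have d0 : 0 < `|u| + 1 by rewrite ltr_wpDl.
(* Small enough for [x + c *: u] to stay in the ball: c |u| < e in the sup norm. *)
pose c := e / (`|u| + 1).
have c0 : 0 < c by rewrite divr_gt0.
have Ax : A x by apply: xeA; exact: ballxx.
have Axc : A (x + c *: u).
  apply: xeA; rewrite -(@ball_normE R 'rV[R]_m.+2) /=.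
  rewrite opprD addrA subrr add0r normrN normrZ gtr0_norm// mulrAC ltr_pdivrMr//.
  by rewrite ltr_pM2l// ltrDl.
have lim_shadow V : orth_frame u V -> _ :=
  fun oV => dir_quotient_covariogram_cvg cA sA u1 oV c0 Ax Axc.
split.
  have [V oV] := orth_frame_exists u1.
  exact: cvgP (lim_shadow V oV).
move=> V oV.
rewrite /lebesgue_hyperplane proj_orth_diff_body//.
rewrite /dir_derivative0 (cvg_lim _ (lim_shadow V oV))// opprK.
have cP : compact (shadow A V) by exact: compact_shadow.
rewrite fineK ?lebesgue_rV_compact_fin//.
rewrite (_ : (2 * m.+2 - 2 = 2 * m.+1)%N); last by rewrite mulnS addKn.
rewrite subSS subn0.
have sP : stable_comb (shadow A V) by exact: stable_comb_shadow.
have P0 : (0 < lebesgue_rV (shadow A V))%E by exact: shadow_gt0 u1 oV.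
by rewrite rogers_shephard//= lebesgue_rV_diff_body_ge.
Qed.
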